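(* Let $(\Omega,\mathcal F,\mu,\{\mathcal F_n\}_{n\ge 0})$ be a filtered probability space, let $\nu\ge1$ and $\nu+1\le p\le r<\infty$, let $w$ be a weight with $w\in (A_p)^{\frac1{p-1}}(A_r)^{\frac1\nu-\frac1{p-1}}$, and let $\{\tau^{(i)}\}_{i\ge0}$ be a conditionally sparse sequence of stopping times with sparsity constant $K$. Let $E_i=\{\tau^{(i)}<\infty\}$ and $$S_\nu|f|=\Big(\sum_{i=0}^\infty \mathbb E\big(|f|\mid\mathcal F^{(i)}_{\tau^{(i)}}\big)^{\nu}\,\mathbf 1_{E_i}\Big)^{1/\nu}.$$ Then for every $f\in L^p(w)$, $$\|S_\nu|f|\|_{L^p(w)}\le C\,[w]_{(A_p)^{\frac1{p-1}}(A_r)^{\frac1\nu-\frac1{p-1}}}\,\|f\|_{L^p(w)},$$ where $C$ depends only on $p,r,\nu$ and $K$ (not on $w$ or $f$).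
   Context: Filtered probability space: $(\Omega,\mathcal F,\mu)$ is a complete probability space, $\{\mathcal F_n\}_{n\ge0}$ is an increasing sequence of sub-$\sigma$-algebras of $\mathcal F$, each $(\Omega,\mathcal F_n,\mu)$ is complete, and $\mathcal F$ is the $\sigma$-algebra generated by $\bigcup_n\mathcal F_n$. Weights: a weight $w$ is a positive random variable in $L^1(\mu)$; $\|f\|_{L^p(w)}=(\int_\Omega|f|^pw\,d\mu)^{1/p}$. Write $g_n=\mathbb E(g\mid\mathcal F_n)$. For $1<q<\infty$ with $w^{-1/(q-1)}\in L^1$, put $A_{n,q}(w)=\big\|w_n\,\big((w^{-1/(q-1)})_n\big)^{q-1}\big\|_\infty$. It is assumed that $w^{-1/(p-1)}\in L^1$. For $\alpha,\beta\ge0$, $[w]_{(A_p)^\alpha(A_r)^\beta}=\sup_{n\ge0}A_{n,p}(w)^\alpha A_{n,r}(w)^\beta$, and $w\in(A_p)^\alpha(A_r)^\beta$ means this quantity is finite. Stopping times: $\tau:\Omega\to\{0,1,2,\dots\}\cup\{\infty\}$ with $\{\tau=n\}\in\mathcal F_n$ for all $n$; $\mathcal F_\tau=\{F\in\mathcal F: F\cap\{\tau\le n\}\in\mathcal F_n\ \forall n\}$. Local space induced by a stopping time $\tau$: if $\mu(\tau<\infty)>0$, it is $(\widetilde\Omega,\widetilde{\mathcal F},\widetilde\mu,\{\widetilde{\mathcal F}_n\})$ with $\widetilde\Omega=\{\tau<\infty\}$, $\widetilde{\mathcal F}=\mathcal F|_{\{\tau<\infty\}}$, $\widetilde{\mathcal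 F}_n=\mathcal F_{\tau+n}|_{\{\tau<\infty\}}$, $\widetilde\mu=\mu|_{\{\tau<\infty\}}/\mu(\tau<\infty)$; any stopping time on this local space is called a locally filter-shifted stopping time relative to $\tau$. If $\mu(\tau<\infty)=0$, the local space is the space on which $\tau$ is defined, and $\tau$ itself is the only locally filter-shifted stopping time relative to $\tau$. Conditional sparsity: let $(\Omega^{(0)},\mathcal F^{(0)},\mu^{(0)},\{\mathcal F^{(0)}_n\})=(\Omega,\mathcal F,\mu,\{\mathcal F_n\})$, $\tau^{(0)}=0$, and for $i\ge0$ let $(\Omega^{(i+1)},\mathcal F^{(i+1)},\mu^{(i+1)},\{\mathcal F^{(i+1)}_n\})$ be the local space induced by the stopping time $\tau^{(i)}$ of $(\Omega^{(i)},\mathcal F^{(i)},\mu^{(i)},\{\mathcal F^{(i)}_n\})$, and $\tau^{(i+1)}$ a locally filter-shifted stopping time relative to $\tau^{(i)}$. Put $E_i=\{\tau^{(i)}<\infty\}$ and $S_i=E_i\setminus E_{i+1}$. The sequence $\{\tau^{(i)}\}_{i\ge0}$ is conditionally sparse if there is a constant $K\ge1$ (the sparsity constant) with $$\mathbf 1_{E_i}\le K\,\mathbb E\big(\mathbf 1_{S_i}\mid\mathcal F^{(i)}_{\tau^{(i)}}\big)\mathbf 1_{E_i}\qquad\text{for all } i\ge0 .$$ Conditional expectations given $\mathcal F^{(i)}_{\tau^{(i)}}$ are taken on $(\Omega^{(i)},\mathcal F^{(i)},\mu^{(i)})$, and their products with $\mathbf 1_{E_i}$ are extended by $0$ to $\Omega$.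 *)

(* Defs.v *)
From HB Require Import structures.
From mathcomp Require Import all_boot all_order all_algebra.
From mathcomp Require Import all_classical all_reals all_analysis.

Set Implicit Arguments.
Unset Strict Implicit.
Unset Printing Implicit Defensive.

Import Order.TTheory GRing.Theory Num.Theory.
Import numFieldNormedType.Exports.

Local Open Scope classical_set_scope.
Local Open Scope ring_scope.

(* Every local space of the iterated construction lives on a measurable subset
   of one ambient space T, whose canonical sigma-algebra plays the role of F.
   Such a space is encoded by its underlying set, its sigma-algebra and its
   filtration (systems of subsets of that underlying set), and its measure,
   viewed as a set function on T that is carried by the underlying set. *)
Record fspace (R : realType) (d : measure_display) (T : measurableType d) :=
  FSpace {
    fs_set : set T;
    fs_sigma : set_system T;
    fs_meas : set T -> \bar R;
    fs_filt : nat -> set_system T }.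

Section FilteredSpaces.
Context (R : realType) (d : measure_display) (T : measurableType d).
Implicit Types (S : fspace R T) (P : probability T R)
  (F : nat -> set_system T) (A B D : set T) (G : set_system T)
  (f g w : T -> R).

Definition filtered_probability_space P F : Prop :=
  [/\ measure_is_complete P,
      forall n, sigma_algebra [set: T] (F n) /\ F n `<=` measurable,
      forall m n, (m <= n)%N -> F m `<=` F n,
      forall n A B, F n A -> P A = 0%E -> B `<=` A -> F n B
    & measurable = <<s \bigcup_n F n >> ].

Definition base_space P F : fspace R T := FSpace [set: T] measurable P F.

(* Random times take values in option nat, None standing for infinity.  Only
   their values on fs_set S are ever used. *)
Definition time : Type := T -> option nat.
Implicit Types tau sigma : time.

Definition time_eq S tau (n : nat) : set T :=
  fs_set S `&` [set x | tau x = Some n].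

Definition time_le S tau (n : nat) : set T :=
  fs_set S `&` [set x | exists2 k, tau x = Some k & (k <= n)%N].

Definition time_fin S tau : set T :=
  fs_set S `&` [set x | tau x <> None].

Definition time_shift tau (n : nat) : time :=
  fun x => omap (fun k => (k + n)%N) (tau x).

Definition is_stopping_time S tau : Prop :=
  forall n, fs_filt S n (time_eq S tau n).

Definition stopped_sigma S tau : set_system T :=
  [set A | fs_sigma S A /\ forall n, fs_filt S n (A `&` time_le S tau n)].

Definition local_space S tau : fspace R T :=
  let E := time_fin S tau in
  if (0 < fs_meas S E)%E then
    FSpace E (strace (fs_sigma S) E)
      (fun A => (fs_meas S (A `&` E) * ((fine (fs_meas S E))^-1)%:E)%E)
      (fun n => strace (stopped_sigma S (time_shift tau n)) E)
  else S.

Definition is_filter_shifted S tau sigma : Prop :=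
  if (0 < fs_meas S (time_fin S tau))%E then
    is_stopping_time (local_space S tau) sigma
  else {in fs_set S, sigma =1 tau}.

Definition is_cond_exp S G f g : Prop :=
  [/\ preimage_set_system (fs_set S) g measurable `<=` G,
      (fs_meas S).-integrable (fs_set S) (EFin \o g)
    & forall A, G A ->
        (\int[fs_meas S]_(x in A) (g x)%:E
           = \int[fs_meas S]_(x in A) (f x)%:E)%E].

(* A chosen version of E(f | G) on the space S; it is meaningful, and unique up
   to a null set, for f integrable and G a sub-sigma-algebra of fs_sigma S. *)
Definition cond_exp S G f : T -> R := xget (cst 0) [set g | is_cond_exp S G f g].

Section Sparse.
Variables (P : probability T R) (F : nat -> set_system T) (tau : nat -> time).

Fixpoint iter_space (i : nat) : fspace R T :=
  if i is j.+1 then local_space (iter_space j) (tau j) else base_space P F.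

Definition Eset (i : nat) : set T := time_fin (iter_space i) (tau i).

Definition Sset (i : nat) : set T := Eset i `\` Eset i.+1.

Definition cond_exp_at (i : nat) f : T -> R :=
  cond_exp (iter_space i) (stopped_sigma (iter_space i) (tau i)) f.

Definition conditionally_sparse (K : R) : Prop :=
  [/\ tau 0%N = cst (Some 0%N),
      forall i, is_filter_shifted (iter_space i) (tau i) (tau i.+1)
    & forall i, {ae P, forall x,
        \1_(Eset i) x <= K * cond_exp_at i \1_(Sset i) x * \1_(Eset i) x}].

Definition sparse_op (nu : R) f : T -> \bar R := fun x =>
  ((\sum_(0 <= i <oo) (cond_exp_at i f x `^ nu * \1_(Eset i) x)%:E) `^ nu^-1)%E.

End Sparse.

Definition weight P w : Prop :=
  P.-integrable [set: T] (EFin \o w) /\ {ae P, forall x, 0 < w x}.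

Definition wLnorm P (p : R) w (h : T -> \bar R) : \bar R :=
  ((\int[P]_x (`|h x| `^ p * (w x)%:E)) `^ p^-1)%E.

Definition in_wLp P (p : R) w f : Prop :=
  measurable_fun [set: T] f /\ (wLnorm P p w (EFin \o f) < +oo)%E.

Definition dual_weight (q : R) w : T -> R := fun x => w x `^ (- (q - 1)^-1).

Definition Aconst P F (n : nat) (q : R) w : \bar R :=
  let E_n := cond_exp (base_space P F) (F n) in
  Lnorm P +oo (fun x => (E_n w x * E_n (dual_weight q w) x `^ (q - 1))%:E).

Definition Achar P F (p a r b : R) w : \bar R :=
  ereal_sup (range (fun n => (Aconst P F n p w `^ a * Aconst P F n r w `^ b)%E)).

End FilteredSpaces.

(* Main.v *)
Require Import Defs.
From mathcomp Require Import all_boot all_order all_algebra.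
From mathcomp Require Import all_classical all_reals all_analysis.
From mathcomp Require Import measurable_realfun ess_sup_inf.
From mathcomp Require Import ring lra.

Set Implicit Arguments.
Unset Strict Implicit.
Unset Printing Implicit Defensive.

Import Order.TTheory GRing.Theory Num.Theory.
Import numFieldNormedType.Exports.
Local Open Scope classical_set_scope.
Local Open Scope ring_scope.

(** A space of the iterated construction is the original space restricted to a
    set [D], with the filtration restarted at a finite absolute time. Hence [E_i]
    splits into sets [L i k] in [F k] on which the conditional expectation of step
    [i] is the one given [F k], and sparsity says [P B <= K * P (B `&` S_i)] for
    the sets [B] of [F k] contained in [L i k], where the [S_i] are disjoint.

    Let [q = p / nu], [s = w^(-1/(p-1))], [t = w^(-1/(r-1))],
    [th = 1 - nu/(p-1)], and write [g_k] for [E(g | F k)]. For a test function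
    [g], the integral of [(f_k)^nu g w] over [L i k] is that of
    [(s_k)^nu w_k (f_k/s_k)^nu ((g w)_k/w_k)], and the characteristic [W] of [w]
    bounds [(s_k)^nu w_k] by [W^nu t_k^(-(r-1) th)]. By Chebyshev's inequality
    [t <= 2 K t_k] on a part of [S_i] that is still sparse, so the integral over
    [L i k] is dominated by that of [w^th (f_k/s_k)^nu ((g w)_k/w_k)] over
    [S_i]. Summing over the disjoint [S_i] leaves [w^th M^nu N], where [M] and [N]
    are the maximal functions of [f/s] and [g] for the measures [s dP] and [w dP].
    Since [w^th = s^(1/q) w^(1/q')], Young's inequality and Doob's inequality for
    these two measures conclude; with [g] the power [q - 1] of the truncated sum
    itself, the [g]-term is absorbed in the left-hand side. *)

(** * Conditioning on a sub-sigma-algebra *)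

Section SubSigma.
Context {R : realType} {d : measure_display} {T : measurableType d}.
Implicit Types (G H : set_system T) (f g X : T -> R).

Definition sub_sigma G := sigma_algebra [set: T] G /\ G `<=` measurable.

(** Stated on the type [g_sigma_algebraType G], so that the closure properties of measurable
    functions apply to [G] directly. *)
Definition meas_wrt G g :=
  measurable_fun [set: g_sigma_algebraType G] (g : g_sigma_algebraType G -> R).

Lemma sub_sigmaE G : sub_sigma G ->
  G = (measurable : set_system (g_sigma_algebraType G)).
Proof. by move=> [sG _]; rewrite measurable_g_measurableTypeE. Qed.

Lemma sub_sigmaI G A B : sub_sigma G -> G A -> G B -> G (A `&` B).
Proof. by move=> /sub_sigmaE ->; exact: measurableI. Qed.

Lemma sub_sigma_bigcup G (A : nat -> set T) : sub_sigma G ->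
  (forall n, G (A n)) -> G (\bigcup_n A n).
Proof.
by move=> /sub_sigmaE -> mA; exact: (@bigcupT_measurable _ (g_sigma_algebraType G)).
Qed.

Lemma sub_sigma0 G : sub_sigma G -> G set0.
Proof. by move=> /sub_sigmaE ->; exact: measurable0. Qed.

Lemma meas_wrtP G g : sub_sigma G ->
  meas_wrt G g <-> preimage_set_system [set: T] g measurable `<=` G.
Proof.
move=> [sG _]; split => [mg A [B mB <-]|h _ B mB].
- have := mg measurableT B mB.
  by rewrite measurable_g_measurableTypeE.
- by rewrite measurable_g_measurableTypeE//; apply: h; exists B.
Qed.

Lemma meas_wrt_sub G H g : sub_sigma G -> sub_sigma H -> G `<=` H ->
  meas_wrt G g -> meas_wrt H g.
Proof.
move=> sG sH GH /meas_wrtP-/(_ sG) h; apply/meas_wrtP => //.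
exact: subset_trans GH.
Qed.

Lemma meas_wrt_measurable G g : sub_sigma G -> meas_wrt G g ->
  measurable_fun [set: T] g.
Proof.
move=> sG /meas_wrtP-/(_ sG) h _ B mB; apply: sG.2; apply: h.
by exists B.
Qed.

Lemma meas_wrt_indic G A : sub_sigma G -> G A -> meas_wrt G (\1_A : T -> R).
Proof.
move=> sG GA; apply: measurable_indic.
by rewrite measurable_g_measurableTypeE//; exact: sG.1.
Qed.

Import HBNNSimple.

(* Approximating [X] by [G]-simple functions reduces the comparison to sets. *)
Lemma le_integral_meas_wrt (mu : {measure set T -> \bar R}) G X f g :
  sub_sigma G -> meas_wrt G X -> (forall x, 0 <= X x) ->
  measurable_fun [set: T] f -> measurable_fun [set: T] g ->
  (forall x, 0 <= f x) -> (forall x, 0 <= g x) ->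
  (forall A, G A -> \int[mu]_(x in A) (f x)%:E <= \int[mu]_(x in A) (g x)%:E)%E ->
  (\int[mu]_x (X x * f x)%:E <= \int[mu]_x (X x * g x)%:E)%E.
Proof.
move=> sG mX X0 mf mg f0 g0 fg.
pose TG := g_sigma_algebraType G.
have mX' : measurable_fun [set: TG] (EFin \o (X : TG -> R)).
  exact/measurable_EFinP.
pose s_ := nnsfun_approx measurableT mX'.
have ms n : measurable_fun [set: T] (s_ n : T -> R).
  apply: (meas_wrt_measurable sG); exact: measurable_funP.
have limE (h : T -> R) : measurable_fun [set: T] h -> (forall x, 0 <= h x) ->
    (\int[mu]_x (X x * h x)%:E = limn (fun n => \int[mu]_x (s_ n x * h x)%:E))%E.
  move=> mh h0; rewrite -monotone_convergence//; last 3 first.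
  - by move=> n; apply/measurable_EFinP; apply: measurable_funM.
  - by move=> n x _; rewrite lee_fin mulr_ge0.
  - move=> x _ a b ab; rewrite lee_fin ler_wpM2r//.
    by move: (nd_nnsfun_approx measurableT mX' ab) => /lefP/(_ x).
  apply: eq_integral => x _; apply/esym/cvg_lim => //.
  under eq_fun do rewrite EFinM.
  rewrite EFinM; apply: cvgeZr => //.
  by apply: (cvg_nnsfun_approx measurableT mX') => // y _; rewrite lee_fin.
rewrite !limE//.
have ndE (h : T -> R) : measurable_fun [set: T] h -> (forall x, 0 <= h x) ->
    nondecreasing_seq (fun n => \int[mu]_x (s_ n x * h x)%:E)%E.
  move=> mh h0 a b ab; apply: ge0_le_integral => //.
  - by move=> x _; rewrite lee_fin mulr_ge0.
  - by apply/measurable_EFinP; apply: measurable_funM.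
  - by apply/measurable_EFinP; apply: measurable_funM.
  - move=> x _; rewrite lee_fin ler_wpM2r//.
    by move: (nd_nnsfun_approx measurableT mX' ab) => /lefP/(_ x).
apply: lee_lim.
- exact/ereal_nondecreasing_is_cvgn/ndE.
- exact/ereal_nondecreasing_is_cvgn/ndE.
apply: nearW => n.
(* The level sets of [s_ n] lie in [G], so both integrals become finite sums to which the hypothesis
   on sets applies. *)
have Gs r : G (s_ n @^-1` [set r]).
  have : measurable (s_ n @^-1` [set r] : set TG) by exact: measurable_funPTI.
  by rewrite measurable_g_measurableTypeE//; exact: sG.1.
have sumE (h : T -> R) : measurable_fun [set: T] h -> (forall x, 0 <= h x) ->
    (\int[mu]_x (s_ n x * h x)%:E = \sum_(r \in range (s_ n))
      (r%:E * \int[mu]_(x in s_ n @^-1` [set r]) (h x)%:E))%E.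
  move=> mh h0.
  transitivity (\int[mu]_x (\sum_(r \in range (s_ n))
      (r * (\1_(s_ n @^-1` [set r]) x * h x))%:E))%E.
    apply: eq_integral => x _.
    rewrite {1}(fimfunE (s_ n)) fsumEFin//; congr EFin.
    rewrite !fsbig_finite//= big_distrl/=.
    by apply: eq_bigr => r _; rewrite mulrA.
  rewrite ge0_integral_fsum//; last 2 first.
  - move=> r; apply/measurable_EFinP; apply: measurable_funM => //.
    apply: measurable_funM => //.
    by apply: (@measurable_indic _ T R); apply: sG.2.
  - move=> r x _; rewrite lee_fin mulrA mulr_ge0//.
    have := nnfun_muleindic_ge0 (s_ n) r x.
    by rewrite -EFinM lee_fin.
  apply: eq_fsbigr => r; rewrite inE => -[y _ yr].
  have r0 : 0 <= r by rewrite -yr.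
  have mA : measurable (s_ n @^-1` [set r] : set T) by exact: sG.2.
  under eq_integral do rewrite EFinM.
  rewrite ge0_integralZl//=; last 2 first.
  - apply/measurable_EFinP; apply: measurable_funM => //.
  - by move=> x _; rewrite lee_fin mulr_ge0.
  congr (_ * _)%E; rewrite [RHS]integral_mkcond; apply: eq_integral => x _.
  by rewrite patchE indicE /=; case: ifPn => _; rewrite ?mul1r ?mul0r.
rewrite !sumE// !fsbig_finite//=.
rewrite big_seq [leRHS]big_seq; apply: lee_sum => r.
rewrite in_fset_set// inE => -[y _ yr].
by apply: lee_wpmul2l; [rewrite lee_fin -yr|exact: fg].
Qed.

End SubSigma.

(** * Existence, uniqueness and positive versions of conditional expectations *)

Section CondExp.
Context {R : realType} {d : measure_display} {T : measurableType d}.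
Variable P : probability T R.
Implicit Types (G H : set_system T) (f g X : T -> R).

(** A relation, so that a version can be taken nonnegative or positive everywhere instead of the one
    picked by [cond_exp]. *)
Definition cexp G f g :=
  [/\ meas_wrt G g, P.-integrable [set: T] (EFin \o g)
    & forall A, G A ->
      (\int[P]_(x in A) (g x)%:E = \int[P]_(x in A) (f x)%:E)%E].

Lemma is_cond_exp_base F G f g : sub_sigma G ->
  is_cond_exp (base_space P F) G f g <-> cexp G f g.
Proof.
by move=> sG; split => -[h1 h2 h3]; split => //; apply/meas_wrtP.
Qed.

(** The version is the Radon-Nikodym derivative, on [G], of the charge with density [f] with respect
    to the restriction of [P]. Both set functions reach [TG] as pushforwards along the identity. *)
Lemma cexp_exists G f : sub_sigma G -> P.-integrable [set: T] (EFin \o f) ->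
  exists g, cexp G f g.
Proof.
move=> sG fi; pose TG := g_sigma_algebraType G.
have mid : measurable_fun [set: T] (id : T -> TG).
  move=> _ B; rewrite measurable_g_measurableTypeE; last exact: sG.1.
  by move=> GB; rewrite setTI; exact: sG.2.
have PG_ex : exists m : {finite_measure set TG -> \bar R}, forall A, m A = P A.
  have [m mE] : exists m : {measure set TG -> \bar R}, forall A, m A = P A.
    pose m : {measure set TG -> \bar R} := pushforward P (id : T -> TG).
    by exists (m mid).
  have mT : (m setT < +oo)%E by rewrite mE ltey_eq fin_num_measure.
  exists (mfrestr measurableT mT) => A.
  by rewrite /= /mfrestr /mrestr setIT mE.
have nu_ex : exists nu : {charge set TG -> \bar R},
    forall A, nu A = (\int[P]_(x in A) (f x)%:E)%E.
  pose nu : {charge set TG -> \bar R} :=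
    pushforward (induced_charge fi) (id : T -> TG).
  by exists (nu mid).
have [PG PGE] := PG_ex; have [nu nuE] := nu_ex.
have PG_push : (PG : set TG -> \bar R) = pushforward P (id : T -> TG).
  by apply/funext => A; rewrite PGE.
have dom : nu `<< PG.
  apply/null_content_dominatesP => A mA A0; rewrite nuE.
  have mA' : measurable (A : set T).
    by have := mid measurableT A mA; rewrite setTI.
  apply: null_set_integral => //.
  - apply: measurable_funTS; exact: measurable_int fi.
  - exact: (etrans (esym (PGE A)) A0).
pose h := Radon_Nikodym nu PG.
have hE x : (fine (h x))%:E = h x by rewrite fineK//; exact: Radon_Nikodym_fin_num.
have hi : PG.-integrable [set: TG] h by exact: Radon_Nikodym_integrable.
exists (fine \o h).
have mh : meas_wrt G (fine \o h).
  apply/measurable_EFinP; apply: eq_measurable_fun (measurable_int _ hi) => x _ /=.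
  by rewrite hE.
have hiP : P.-integrable [set: T] (EFin \o (fine \o h)).
  apply/integrableP; split.
    by apply/measurable_EFinP; exact: meas_wrt_measurable mh.
  case/integrableP: hi => mh' hlt.
  move: hlt; rewrite PG_push ge0_integral_pushforward//; last first.
    exact: measurableT_comp.
  by under eq_integral do rewrite /= -hE.
split => // A GA.
have mA : measurable (A : set TG).
  by rewrite measurable_g_measurableTypeE//; exact: sG.1.
rewrite -nuE (Radon_Nikodym_integral dom mA).
transitivity (\int[pushforward P (id : T -> TG)]_(x in A) h x)%E; last first.
  by rewrite -PG_push.
rewrite integral_pushforward//.
- by apply: eq_integral => x _; rewrite /= hE.
- exact: measurable_int hi.
- apply: (@integrableS _ _ _ P setT) => //; first exact: sG.2.
  by apply: eq_integrable hiP => // x _ /=; rewrite hE.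
Qed.

Lemma measure0_le0_integral A f : measurable A -> measurable_fun A f ->
  (forall x, A x -> 0 < f x) -> (\int[P]_(x in A) (f x)%:E <= 0)%E -> P A = 0%E.
Proof.
move=> mA mf f0 le0.
have /ae_eq_integral_abs : measurable_fun A (EFin \o f) by exact/measurable_EFinP.
move=> /(_ P mA) [h _].
have /h : (\int[P]_(x in A) `|(EFin \o f) x| = 0)%E.
  apply/eqP; rewrite eq_le integral_ge0 ?andbT//.
  apply: le_trans le0; rewrite le_eqVlt; apply/orP; left; apply/eqP.
  by apply: eq_integral => x; rewrite inE => Ax /=; rewrite gtr0_norm// f0.
move=> [N [mN N0 AN]]; apply: (subset_measure0 mA mN _ N0).
move=> x Ax; apply: AN => /= h0; have [fx0] := h0 Ax.
by have := f0 x Ax; rewrite fx0 ltxx.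
Qed.

Lemma meas_wrt_preimage G g B : sub_sigma G -> meas_wrt G g -> measurable B ->
  G (g @^-1` B).
Proof.
move=> sG /meas_wrtP-/(_ sG) h mB; apply: h; exists B => //.
by rewrite setTI.
Qed.

Lemma integrable_ae_eq f g : P.-integrable [set: T] (EFin \o f) ->
  measurable_fun [set: T] g -> {ae P, forall x, f x = g x} ->
  P.-integrable [set: T] (EFin \o g).
Proof.
move=> fi mg fg; apply/integrableP; split; first exact/measurable_EFinP.
have mf : measurable_fun [set: T] f by apply/measurable_EFinP; exact: measurable_int fi.
case/integrableP: fi => _; apply: le_lt_trans.
apply: ae_ge0_le_integral => //.
- by apply: measurableT_comp => //; exact/measurable_EFinP.
- by apply: measurableT_comp => //; exact/measurable_EFinP.
- by apply: filterS fg => x /= ->.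
Qed.

Lemma cexp_congr G f f' g : sub_sigma G -> measurable_fun [set: T] f ->
  measurable_fun [set: T] f' -> {ae P, forall x, f x = f' x} ->
  cexp G f g -> cexp G f' g.
Proof.
move=> sG mf mf' ff' [mg gi gE]; split => // A GA; rewrite gE//.
apply: ae_eq_integral; first exact: sG.2.
- by apply/measurable_EFinP; exact: measurable_funTS.
- by apply/measurable_EFinP; exact: measurable_funTS.
- by apply: filterS ff' => x /= ->.
Qed.

Lemma cexp_ae_eq G f g g' : sub_sigma G -> cexp G f g -> meas_wrt G g' ->
  {ae P, forall x, g x = g' x} -> cexp G f g'.
Proof.
move=> sG [mg gi gE] mg' gg'.
have mgT := meas_wrt_measurable sG mg.
have mgT' := meas_wrt_measurable sG mg'.
split => //.
- exact: integrable_ae_eq gg'.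
- move=> A GA; rewrite -gE//; apply: ae_eq_integral.
  + exact: sG.2.
  + by apply/measurable_EFinP; exact: measurable_funTS.
  + by apply/measurable_EFinP; exact: measurable_funTS.
  + by apply: filterS gg' => x /= ->.
Qed.

(** Almost sure uniqueness, localised to [E]: it serves to compare a conditional expectation on a
    local space with the one given [F k], which can be done on a level set only. *)
Lemma ae_eq_on_meas_wrt G E g g' : sub_sigma G -> G E ->
  meas_wrt G g -> meas_wrt G g' -> P.-integrable [set: T] (EFin \o g') ->
  (forall A, G A -> A `<=` E ->
    (\int[P]_(x in A) (g x)%:E = \int[P]_(x in A) (g' x)%:E)%E) ->
  {ae P, forall x, E x -> g x = g' x}.
Proof.
move=> sG GE mg mg' g'i gg'; pose TG := g_sigma_algebraType G.
have mid : measurable_fun [set: T] (id : T -> TG).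
  move=> _ B; rewrite measurable_g_measurableTypeE; last exact: sG.1.
  by move=> GB; rewrite setTI; exact: sG.2.
have mE : measurable (E : set TG).
  by rewrite measurable_g_measurableTypeE//; exact: sG.1.
have mgT := meas_wrt_measurable sG mg.
pose m0 : {measure set TG -> \bar R} := pushforward P (id : T -> TG).
have [m mP] : exists m : {measure set TG -> \bar R},
  (m : set TG -> \bar R) = pushforward P (id : T -> TG) by exists (m0 mid).
have mge : measurable_fun [set: TG] (EFin \o (g : TG -> R)) by exact/measurable_EFinP.
have mge' : measurable_fun [set: TG] (EFin \o (g' : TG -> R)).
  exact/measurable_EFinP.
have g'iE A : G A -> P.-integrable A (EFin \o g').
  by move=> GA; apply: integrableS g'i => //; exact: sG.2.
(* Integrability of [g] on [A] comes from the equality of integrals, the one of [g'] being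
   finite. *)
have giE A : G A -> A `<=` E -> P.-integrable A (EFin \o g).
  move=> GA AE; apply/integrableP; split.
    by apply/measurable_EFinP; exact: measurable_funTS.
  have mA := sG.2 _ GA; apply/abse_integralP => //.
    by apply/measurable_EFinP; exact: measurable_funTS.
  rewrite /= gg'//; have /integrableP[mg'A g'A] := g'iE _ GA.
  exact/abse_integralP.
have : ae_eq m E (EFin \o (g' : TG -> R)) (EFin \o (g : TG -> R)).
  apply: integral_ae_eq => //.
  - by rewrite mP; apply: integrable_pushforward => //; exact: g'iE.
  - exact: measurable_funTS.
  - move=> A AE mA.
    have GA : G A by rewrite measurable_g_measurableTypeE// in mA; exact: sG.1.
    rewrite mP integral_pushforward//; last exact: g'iE.
    by rewrite integral_pushforward//; [rewrite -gg'|exact: giE].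
move=> [N [mN N0 AN]]; exists N; split.
- by have := mid measurableT N mN; rewrite setTI.
- by rewrite mP in N0.
- move=> x /= nx; apply: AN => /= h; apply: nx => Ex.
  by have [] := h Ex.
Qed.

(** On [{g < 0}], a set of [G], the integral of [g] equals that of [f] and is nonnegative. Hence
    this set is null and the positive part of [g] is still a version. *)
Lemma cexp_ge0_version G f g : sub_sigma G -> (forall x, 0 <= f x) -> cexp G f g ->
  cexp G f (fun x => Num.max (g x) 0).
Proof.
move=> sG f0 cg; have [mg gi gE] := cg.
have mgT := meas_wrt_measurable sG mg.
pose A := g @^-1` [set t | t < 0].
have mlt : measurable [set t : R | t < 0].
  by rewrite -[X in measurable X]set_itvNyo.
have GA : G A by exact: meas_wrt_preimage.
have PA : P A = 0%E.
  apply: (@measure0_le0_integral A (fun x => - g x)) => //.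
  - exact: sG.2.
  - by apply: measurable_funTS; exact: measurableT_comp.
  - by move=> x; rewrite /A /= oppr_gt0.
  - under eq_integral do rewrite EFinN.
    rewrite integralN/=; last first.
      apply: integrable_add_def (integrableS _ _ _ gi) => //; exact: sG.2.
    rewrite oppe_le0 gE//; apply: integral_ge0 => x _; exact: f0.
have aeE : {ae P, forall x, g x = Num.max (g x) 0}.
  exists A; split => //; first exact: sG.2.
  move=> x /=; apply: contra_notP; rewrite /A/= => /negP; rewrite -leNgt => h.
  by rewrite max_l.
apply: cexp_ae_eq cg _ aeE => //.
exact: measurable_maxr.
Qed.

Lemma nonneg_versions (F : nat -> set_system T) f :
  (forall n, sub_sigma (F n)) -> P.-integrable [set: T] (EFin \o f) ->
  (forall x, 0 <= f x) ->
  exists f_ : nat -> T -> R,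
    (forall n, cexp (F n) f (f_ n)) /\ forall n x, 0 <= f_ n x.
Proof.
move=> sF fi f0.
have /choice[f_ f_P] : forall n, exists g, cexp (F n) f g /\ forall x, 0 <= g x.
  move=> n; have [g cg] := cexp_exists (sF n) fi.
  exists (fun x => Num.max (g x) 0); split; first exact: cexp_ge0_version cg.
  by move=> x; rewrite le_max lexx orbT.
by exists f_; split => n; have [] := f_P n.
Qed.

(** The set [{g <= 0}] is null by the same argument, and [g] is given the value [1] there. Such
    versions can serve as denominators everywhere. *)
Lemma cexp_gt0_version G f g : sub_sigma G -> P.-integrable [set: T] (EFin \o f) ->
  (forall x, 0 < f x) -> cexp G f g ->
  exists2 g', cexp G f g' & (forall x, 0 < g' x) /\ {ae P, forall x, g x = g' x}.
Proof.
move=> sG fi f0 cg; have [mg gi gE] := cg.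
have mgT := meas_wrt_measurable sG mg.
pose A := g @^-1` [set t | t <= 0].
have mlt : measurable [set t : R | t <= 0].
  by rewrite -[X in measurable X]set_itvNyc.
have GA : G A by exact: meas_wrt_preimage.
have PA : P A = 0%E.
  apply: (@measure0_le0_integral A f) => //.
  - exact: sG.2.
  - by apply: measurable_funTS; apply/measurable_EFinP; exact: measurable_int fi.
  - rewrite -gE// -[leRHS](integral0 P A); apply: le_integral => //.
    + exact: sG.2.
    + by apply: integrableS gi => //; exact: sG.2.
    + by apply: integrable0; exact: sG.2.
    + by move=> x; rewrite inE => Ax; rewrite lee_fin.
pose g' x := if 0 < g x then g x else 1.
have aeE : {ae P, forall x, g x = g' x}.
  exists A; split => //; first exact: sG.2.
  move=> x /=; apply: contra_notP; rewrite /A/= => /negP; rewrite -ltNge => h.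
  by rewrite /g' h.
exists g'; last by split => // x; rewrite /g'; case: ifPn.
apply: cexp_ae_eq cg _ aeE => //.
apply: measurable_fun_ifT => //.
exact: measurable_fun_ltr.
Qed.

End CondExp.

(** * Doob's inequality for a weighted measure *)

Section RealInequalities.
Context {R : realType}.
Implicit Types (p a b t m : R).

Lemma conj_exponentE p : 1 < p -> p^-1 + (p / (p - 1))^-1 = 1.
Proof.
move=> p1; have p0 : p != 0 by apply/eqP; lra.
by rewrite invf_div -[X in X + _]div1r -mulrDl addrC subrK divff.
Qed.

Lemma powR_pred_conj p a : 1 < p -> (a `^ (p - 1)) `^ (p / (p - 1)) = a `^ p.
Proof.
move=> p1; rewrite -powRrM mulrCA divff ?mulr1//; apply/eqP; lra.
Qed.

(** Young's inequality for [b] times [a^(p-1)], rearranged; a discrete form of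
    [d(t^p) = p/(p-1) t d(t^(p-1))]. *)
Lemma powR_diff_le p a b : 1 < p -> 0 <= a -> a <= b ->
  b `^ p - a `^ p <= p / (p - 1) * (b * (b `^ (p - 1) - a `^ (p - 1))).
Proof.
move=> p1 a0 ab; have b0 : 0 <= b by lra.
have := conjugate_powR (a := b) (b := a `^ (p - 1)) b0 (powR_ge0 _ _) _ _
  (conj_exponentE p1).
rewrite powR_pred_conj// => /(_ ltac:(lra)) /(_ ltac:(apply: divr_gt0; lra)).
rewrite mulrBr mulr_powRB1//; last lra.
set A := a `^ p; set B := b `^ p; set C := b * _; rewrite invf_div.
move=> h; have p0 : 0 < p - 1 by lra.
have p0' : 0 < p by lra.
rewrite -(ler_pM2l p0).
have -> : (p - 1) * (p / (p - 1) * (B - C)) = p * (B - C) by field; apply/eqP; lra.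
move: h => /(ler_wpM2l (ltW p0')).
have -> : p * (B / p + A * ((p - 1) / p)) = B + (p - 1) * A.
  by field; apply/eqP; lra.
lra.
Qed.

(** Young's inequality for [2 p' t] and [m^(p-1) / 2]: this scaling makes the coefficient of [m^p]
    at most one half, so that the term can be absorbed. *)
Lemma young_half p t m : 1 < p -> 0 <= t -> 0 <= m ->
  p / (p - 1) * (t * m `^ (p - 1)) <=
    (2 * (p / (p - 1))) `^ p * t `^ p + 2^-1 * m `^ p.
Proof.
move=> p1 t0 m0; set p' := p / (p - 1).
have p'1 : 1 < p' by rewrite /p' ltr_pdivlMr; lra.
have := conjugate_powR (a := 2 * p' * t) (b := 2^-1 * m `^ (p - 1))
  _ _ _ _ (conj_exponentE p1).
move=> /(_ ltac:(by rewrite mulr_ge0//; lra)).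
move=> /(_ ltac:(by rewrite mulr_ge0// ?powR_ge0; lra)).
move=> /(_ ltac:(lra)) /(_ ltac:(rewrite -/p'; lra)).
rewrite -/p' powRM ?powR_ge0//; [|lra..].
rewrite [(2^-1 * _) `^ _]powRM ?powR_ge0//; [|lra..].
rewrite powR_pred_conj//; move=> h.
have -> : p' * (t * m `^ (p - 1)) = 2 * p' * t * (2^-1 * m `^ (p - 1)) by field.
apply: (le_trans h); apply: lerD.
- rewrite ler_pdivrMr; last lra.
  by apply: ler_peMr; [rewrite mulr_ge0 ?powR_ge0|lra].
- rewrite ler_pdivrMr; last lra.
  apply: le_trans (_ : 2^-1 * m `^ p <= _).
    apply: ler_wpM2r; first exact: powR_ge0.
    rewrite -[leRHS]powRr1; last lra.
    by apply: ger_powR; lra.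
  by apply: ler_peMr; [rewrite mulr_ge0 ?powR_ge0//; lra|lra].
Qed.

(** One step of the telescoping sum: [a] is the running maximum and [x] the next value. For [x <= a]
    both sides vanish; otherwise the new truncated maximum is at most [x], which may replace it as a
    factor. *)
Lemma min_powR_diff_le p L a x : 1 < p -> 0 <= L -> 0 <= a -> 0 <= x ->
  Num.min L (Num.max a x) `^ p - Num.min L a `^ p <=
    p / (p - 1) * (x * (Num.min L (Num.max a x) `^ (p - 1)
                        - Num.min L a `^ (p - 1))).
Proof.
move=> p1 L0 a0 x0; case: (leP x a) => [xa|ax].
  by rewrite !subrr !mulr0.
have la : 0 <= Num.min L a by rewrite le_min L0.
have lab : Num.min L a <= Num.min L x.
  by rewrite le_min ge_min lexx/= ge_min (ltW ax) orbT.
apply: (le_trans (powR_diff_le p1 la lab)).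
apply: ler_wpM2l; first by rewrite divr_ge0//; lra.
apply: ler_wpM2r; last by rewrite ge_min lexx orbT.
rewrite subr_ge0 ge0_ler_powR// ?nnegrE; first lra.
exact: le_trans lab.
Qed.

End RealInequalities.

(** * Monotone limits and absorption *)

Section IntegralBounds.
Context {R : realType} {d : measure_display} {T : measurableType d}.
Variable P : probability T R.
Local Open Scope ereal_scope.

Lemma cvg_integral_le (h_ : nat -> T -> \bar R) (h : T -> \bar R) (B : \bar R) :
  (forall n, measurable_fun [set: T] (h_ n)) ->
  (forall n x, 0 <= h_ n x) ->
  (forall x, {homo h_ ^~ x : m n / (m <= n)%N >-> m <= n}) ->
  (forall x, h_ ^~ x @ \oo --> h x) ->
  (forall n, \int[P]_x h_ n x <= B) -> \int[P]_x h x <= B.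
Proof.
move=> mh h0 ndh hh hB.
have -> : \int[P]_x h x = limn (fun n => \int[P]_x h_ n x).
  rewrite -monotone_convergence//.
  by apply: eq_integral => x _; apply/esym/cvg_lim => //; exact: hh.
apply: lime_le; last by apply: nearW => n; exact: hB.
apply: ereal_nondecreasing_is_cvgn => m n mn; apply: ge0_le_integral => //.
by move=> x _; exact: ndh.
Qed.

(** Finiteness of [x] allows half of it to be subtracted from both sides; the truncations below are
    there to secure it. *)
Lemma absorb_half (x A : \bar R) : 0 <= x -> x < +oo ->
  x <= A + (2^-1)%:E * x -> x <= 2%:E * A.
Proof.
case: x => [x| |]//; case: A => [A| |]//=.
- by rewrite -EFinM -EFinD !lee_fin; lra.
- by rewrite gt0_muley ?leey// lte_fin; lra.
Qed.

End IntegralBounds.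

(** Only terms of index below [n] enter, so the maximum at [n.+1] of an adapted sequence is
    measurable for [F n]. The starting value [0] suits nonnegative sequences. *)
Fixpoint running_max {R : realType} (h : nat -> R) (n : nat) : R :=
  if n is m.+1 then Num.max (running_max h m) (h m) else 0.

Section MeasurablePower.
Context {R : realType} {d : measure_display} {T : measurableType d}.
Implicit Types f g : T -> R.

Lemma measurable_fun_powR f (p : R) : measurable_fun [set: T] f ->
  measurable_fun [set: T] (fun x => f x `^ p).
Proof.
by move=> mf; exact: (@measurableT_comp _ _ _ _ _ _ (@powR R ^~ p)).
Qed.

Lemma measurable_fun_divr f g : measurable_fun [set: T] f ->
  measurable_fun [set: T] g -> (forall x, 0 < g x) ->
  measurable_fun [set: T] (fun x => f x / g x).
Proof.
move=> mf mg g0; rewrite (_ : (fun x => _) = (fun x => f x * g x `^ (-1))).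
  by apply: measurable_funM => //; exact: measurable_fun_powR.
by apply/funext => x; rewrite powR_inv1// ltW.
Qed.

Lemma measurable_fun_running_max (n : nat) (h : nat -> T -> R) :
  (forall k, (k < n)%N -> measurable_fun [set: T] (h k)) ->
  measurable_fun [set: T] (fun x => running_max (h ^~ x) n).
Proof.
elim: n => [|n ih] mh /=; first exact: measurable_cst.
apply: measurable_maxr; last exact: mh.
by apply: ih => k kn; apply: mh; exact: ltnW.
Qed.

End MeasurablePower.

Lemma running_max_ge0 {R : realType} (n : nat) (h : nat -> R) :
  0 <= running_max h n.
Proof. by elim: n => //= n ih; rewrite le_max ih. Qed.

Lemma le_running_max {R : realType} (n k : nat) (h : nat -> R) : (k < n)%N ->
  h k <= running_max h n.
Proof.
elim: n => // n ih; rewrite ltnS leq_eqVlt => /predU1P[->|kn] /=.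
  by rewrite le_max lexx orbT.
by rewrite le_max ih.
Qed.

(** [(2 p')^p] is the coefficient in [young_half], with [p' = p / (p - 1)]; the outer [2] comes from
    the absorption. *)
Definition doob_const {R : realType} (p : R) : R := 2 * (2 * (p / (p - 1))) `^ p.

Lemma doob_const_ge0 {R : realType} (p : R) : 0 <= doob_const p.
Proof. by rewrite mulr_ge0// powR_ge0. Qed.

(** * Doob's inequality by telescoping *)

Section Doob.
Context {R : realType} {d : measure_display} {T : measurableType d}.
Variables (P : probability T R) (F : nat -> set_system T).
Hypotheses (sF : forall n, sub_sigma (F n))
  (ndF : forall m n, (m <= n)%N -> F m `<=` F n).

(** The comparison on sets of [G], extended to the test function [X], is applied in both
    directions. *)
Lemma cexp_pull_out G (X f g : T -> R) : sub_sigma G ->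
  measurable_fun [set: T] f -> (forall x, 0 <= f x) -> (forall x, 0 <= g x) ->
  cexp P G f g -> meas_wrt G X -> (forall x, 0 <= X x) ->
  (\int[P]_x (X x * f x)%:E = \int[P]_x (X x * g x)%:E)%E.
Proof.
move=> sG mf f0 g0 [mg gi gE] mX X0.
have mgT := meas_wrt_measurable sG mg.
by apply/eqP; rewrite eq_le; apply/andP; split;
  apply: (le_integral_meas_wrt sG) => // A GA; rewrite gE.
Qed.

Variables (p : R) (u phi : T -> R) (u_ phi_ : nat -> T -> R).
Hypotheses (p1 : 1 < p) (u0 : forall x, 0 < u x) (phi0 : forall x, 0 <= phi x)
  (ui : P.-integrable [set: T] (EFin \o u))
  (mphi : measurable_fun [set: T] phi)
  (cu : forall n, cexp P (F n) u (u_ n)) (cphi : forall n, cexp P (F n) phi (phi_ n))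
  (u_0 : forall n x, 0 < u_ n x) (phi_0 : forall n x, 0 <= phi_ n x).

Let p0 : 0 < p. Proof. exact: lt_trans p1. Qed.

Let p10 : 0 < p - 1. Proof. by rewrite subr_gt0. Qed.

(** By Bayes' formula [X k] is the conditional expectation of [phi / u] given [F k] for the measure
    [u dP], and [M] below is its maximal function. *)
Let X k x := phi_ k x / u_ k x.
Let M n x := running_max (X ^~ x) n.

Let mu : measurable_fun [set: T] u.
Proof. by apply/measurable_EFinP; exact: measurable_int ui. Qed.

Let mX k n : (k <= n)%N -> meas_wrt (F n) (X k).
Proof.
move=> kn; apply: (meas_wrt_sub (sF k) (sF n) (ndF kn)).
have [mphi_ _ _] := cphi k; have [mu_ _ _] := cu k.
exact: measurable_fun_divr.
Qed.

Let mM k n : (k <= n.+1)%N -> meas_wrt (F n) (M k).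
Proof.
move=> kn; apply: measurable_fun_running_max => j jk; apply: mX.
by rewrite -ltnS (leq_trans jk).
Qed.

Let M0 n x : 0 <= M n x. Proof. exact: running_max_ge0. Qed.

Let X0 n x : 0 <= X n x. Proof. by rewrite divr_ge0// ltW. Qed.

Let mMT n : measurable_fun [set: T] (M n).
Proof. exact: (meas_wrt_measurable (sF n) (mM (leqnSn n))). Qed.

Let W L n x := Num.min L (M n x).

Let W0 L n x : 0 <= L -> 0 <= W L n x.
Proof. by move=> L0; rewrite le_min L0/=. Qed.

Let mW L n : measurable_fun [set: T] (W L n).
Proof. exact: measurable_minr. Qed.

(* The increments of the powers of the truncated running maximum are adapted, so
   conditioning replaces [X k * u] by [phi] in each term of the telescoping sum. *)
Lemma weighted_doob_trunc (L : R) (N : nat) : 0 <= L ->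
  (\int[P]_x (W L N x `^ p * u x)%:E <=
    (doob_const p)%:E * \int[P]_x ((phi x / u x) `^ p * u x)%:E)%E.
Proof.
move=> L0; pose p' := p / (p - 1).
have p'0 : 0 <= p'.
  by apply: divr_ge0; exact: ltW.
pose D k x := W L k.+1 x `^ (p - 1) - W L k x `^ (p - 1).
have WS k x : W L k.+1 x = Num.min L (Num.max (M k x) (X k x)).
  by [].
have D0 k x : 0 <= D k x.
  rewrite subr_ge0; apply: ge0_ler_powR; rewrite ?nnegrE ?W0//; first exact: ltW.
  by rewrite WS /W le_min !ge_min lexx/=; apply/orP; right; rewrite le_max lexx.
have mD k : meas_wrt (F k) (D k).
  by apply: measurable_funB; apply: measurable_fun_powR;
    apply: measurable_minr => //; apply: mM.
have mDT k : measurable_fun [set: T] (D k) by exact: meas_wrt_measurable (mD k).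
have mXT k : measurable_fun [set: T] (X k).
  by apply: (meas_wrt_measurable (sF k)); exact: mX.
(* Telescoping over the truncated maxima; the initial one is [min L 0 = 0], whose power vanishes. *)
have step1 x : W L N x `^ p <= \sum_(k < N) p' * (X k x * D k x).
  have : W L N x `^ p - W L 0 x `^ p <= \sum_(k < N) p' * (X k x * D k x).
    elim: (N) => [|n ih]; first by rewrite subrr big_ord0.
    rewrite big_ord_recr/= -(subrK (W L n x `^ p) (W L n.+1 x `^ p)).
    rewrite -addrA addrC; apply: lerD => //.
    rewrite /D !WS; exact: min_powR_diff_le.
  by rewrite {2}/W /M /= min_r// powR0 ?subr0// (gt_eqF p0).
(* Conditioning is used twice: [u] becomes [u_ k], which cancels the denominator of [X k], and the
   remaining [phi_ k] becomes [phi]. *)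
have step2 k : (\int[P]_x (X k x * D k x * u x)%:E = \int[P]_x (D k x * phi x)%:E)%E.
  rewrite (@cexp_pull_out (F k) (fun x => X k x * D k x) u (u_ k))//; last 4 first.
  - by move=> x; exact: ltW.
  - by move=> x; exact: ltW.
  - by apply: measurable_funM; [exact: mX|exact: mD].
  - by move=> x; rewrite mulr_ge0.
  rewrite (@cexp_pull_out (F k) (D k) phi (phi_ k))//.
  apply: eq_integral => x _; rewrite /X mulrAC divfK ?gt_eqF//.
  by rewrite mulrC.
have fin : (\int[P]_x (W L N x `^ p * u x)%:E < +oo)%E.
  apply: (@le_lt_trans _ _ (\int[P]_x (L `^ p * u x)%:E)%E).
    apply: ge0_le_integral => //.
    - by move=> x _; rewrite lee_fin mulr_ge0 ?powR_ge0// ltW.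
    - apply/measurable_EFinP; apply: measurable_funM => //.
      exact: measurable_fun_powR.
    - by apply/measurable_EFinP; apply: measurable_funM.
    - move=> x _; rewrite lee_fin ler_wpM2r ?(ltW (u0 x))//.
      apply: ge0_ler_powR; rewrite ?nnegrE ?W0//; first exact: ltW.
      by rewrite /W ge_min lexx.
  under eq_integral do rewrite EFinM.
  rewrite ge0_integralZl//; last 3 first.
  - exact/measurable_EFinP.
  - by move=> x _; rewrite lee_fin ltW.
  - by rewrite lee_fin powR_ge0.
  rewrite lte_mul_pinfty ?lee_fin ?powR_ge0//.
  case/integrableP: ui => _; apply: le_lt_trans.
  by under [leRHS]eq_integral do rewrite /= gtr0_norm//.
have bound : (\int[P]_x (W L N x `^ p * u x)%:E <=
    p'%:E * \int[P]_x (phi x * W L N x `^ (p - 1))%:E)%E.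
  apply: (@le_trans _ _
    (\int[P]_x (\sum_(k < N) (p' * (X k x * D k x * u x))%:E))%E).
    apply: ge0_le_integral => //.
    - by move=> x _; rewrite lee_fin mulr_ge0 ?powR_ge0// ltW.
    - apply/measurable_EFinP; apply: measurable_funM => //.
      exact: measurable_fun_powR.
    - under eq_fun do rewrite sumEFin.
      apply/measurable_EFinP; apply: measurable_sum => k.
      by repeat apply: measurable_funM => //.
    - move=> x _; rewrite sumEFin lee_fin.
      under eq_bigr do rewrite mulrA.
      by rewrite -big_distrl/= ler_wpM2r// ltW.
  rewrite ge0_integral_sum//; last 2 first.
  - move=> k; apply/measurable_EFinP; apply: measurable_funM => //.
    by repeat apply: measurable_funM => //.
  - move=> k x _; rewrite lee_fin mulr_ge0// mulr_ge0//; last exact: ltW.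
    by rewrite mulr_ge0.
  have -> : (\sum_(k < N) \int[P]_x (p' * (X k x * D k x * u x))%:E =
      \sum_(k < N) \int[P]_x (p' * (D k x * phi x))%:E)%E.
    apply: eq_bigr => k _.
    under eq_integral do rewrite EFinM.
    rewrite ge0_integralZl//; last 2 first.
    + by apply/measurable_EFinP; repeat apply: measurable_funM => //.
    + move=> x _; rewrite lee_fin; apply: mulr_ge0; last exact: ltW.
      exact: mulr_ge0.
    rewrite step2 -ge0_integralZl//.
    + by apply/measurable_EFinP; repeat apply: measurable_funM => //.
    + by move=> x _; rewrite lee_fin !mulr_ge0.
  rewrite -ge0_integral_sum//; last 2 first.
  - by move=> k; apply/measurable_EFinP; repeat apply: measurable_funM => //.
  - move=> k x _; rewrite lee_fin; apply: mulr_ge0 => //; exact: mulr_ge0.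
  rewrite -ge0_integralZl//; last 2 first.
  - apply/measurable_EFinP; apply: measurable_funM => //.
    exact: measurable_fun_powR.
  - by move=> x _; rewrite lee_fin mulr_ge0 ?powR_ge0.
  rewrite le_eqVlt; apply/orP; left; apply/eqP; apply: eq_integral => x _.
  rewrite sumEFin -EFinM; congr EFin; rewrite -big_distrr/= -big_distrl/=.
  rewrite [(\sum_(_ < _) _) * _]mulrC; congr (_ * (_ * _)).
  (* The increments [D k] add up to the power [p - 1] of the last truncated maximum. *)
  rewrite -(big_mkord xpredT (fun k => D k x)) telescope_sumr//.
  by rewrite {2}/W /M /= min_r// powR0 ?subr0// (gt_eqF p10).
have mt : measurable_fun [set: T] (fun x => (phi x / u x) `^ p).
  by apply: measurable_fun_powR; exact: measurable_fun_divr.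
rewrite /doob_const EFinM -muleA; apply: absorb_half => //.
  by apply: integral_ge0 => x _; rewrite lee_fin mulr_ge0 ?powR_ge0// ltW.
apply: (le_trans bound).
rewrite -ge0_integralZl//; last 2 first.
- apply/measurable_EFinP; apply: measurable_funM => //.
  exact: measurable_fun_powR.
- by move=> x _; rewrite lee_fin mulr_ge0 ?powR_ge0.
rewrite -[X in (_ <= X + _)%E]ge0_integralZl//; last 3 first.
- by apply/measurable_EFinP; apply: measurable_funM.
- by move=> x _; rewrite lee_fin mulr_ge0 ?powR_ge0// ltW.
- by rewrite lee_fin powR_ge0.
rewrite -[X in (_ <= _ + X)%E]ge0_integralZl//; last 2 first.
- apply/measurable_EFinP; apply: measurable_funM => //.
  exact: measurable_fun_powR.
- by move=> x _; rewrite lee_fin mulr_ge0 ?powR_ge0// ltW.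
rewrite -ge0_integralD//; last 4 first.
- by move=> x _; rewrite -EFinM lee_fin !mulr_ge0 ?powR_ge0// ltW.
- by apply/measurable_EFinP; apply: measurable_funM => //; apply: measurable_funM.
- by move=> x _; rewrite -EFinM lee_fin !mulr_ge0 ?powR_ge0// ltW.
- apply/measurable_EFinP; apply: measurable_funM => //; apply: measurable_funM => //.
  exact: measurable_fun_powR.
apply: ge0_le_integral => //.
- by move=> x _; rewrite -EFinM lee_fin mulr_ge0// mulr_ge0 ?powR_ge0.
- apply/measurable_EFinP; apply: measurable_funM => //; apply: measurable_funM => //.
  exact: measurable_fun_powR.
- apply/measurable_EFinP; apply: measurable_funD.
    by apply: measurable_funM => //; apply: measurable_funM.
  apply: measurable_funM => //; apply: measurable_funM => //.
  exact: measurable_fun_powR.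
move=> x _; rewrite -!EFinM -EFinD lee_fin.
have t0 : 0 <= phi x / u x by rewrite divr_ge0// ltW.
have un0 : u x != 0 by rewrite gt_eqF.
(* Young's inequality with [t = phi / u] and [m] the truncated maximum, multiplied by [u]. *)
have := ler_wpM2r (ltW (u0 x)) (young_half p1 t0 (W0 N x L0)).
rewrite -/p' mulrDl -!mulrA; apply: le_trans.
by rewrite [W L N x `^ _ * u x]mulrC mulKf.
Qed.

Lemma weighted_doob (N : nat) :
  (\int[P]_x (running_max (fun k => phi_ k x / u_ k x) N `^ p * u x)%:E <=
    (doob_const p)%:E * \int[P]_x ((phi x / u x) `^ p * u x)%:E)%E.
Proof.
apply: (@cvg_integral_le _ _ _ P (fun n x => (W n%:R N x `^ p * u x)%:E)).
- move=> n; apply/measurable_EFinP; apply: measurable_funM => //.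
  exact: measurable_fun_powR.
- by move=> n x; rewrite lee_fin mulr_ge0 ?powR_ge0// ltW.
- move=> x m n mn; rewrite lee_fin ler_wpM2r ?(ltW (u0 x))//.
  apply: ge0_ler_powR; rewrite ?nnegrE ?W0//; first exact: ltW.
  by rewrite /W le_min !ge_min lexx orbT andbT ler_nat mn.
- move=> x; apply: cvg_near_cst; near=> n.
  rewrite /W min_r//; near: n; exact: nbhs_infty_ger.
- by move=> n; exact: weighted_doob_trunc.
Unshelve. all: by end_near. Qed.

End Doob.

(** * The weighted estimate for sparse sets *)

Lemma measure_integral_indic {R : realType} {d : measure_display}
    {T : measurableType d} (mu : {measure set T -> \bar R}) (A : set T) :
  measurable A -> mu A = (\int[mu]_x (\1_A x)%:E)%E.
Proof. by move=> mA; rewrite integral_indic// setIT. Qed.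

(** * Passing from a set of the filtration to its sparse part *)

Section SparseTransfer.
Context {R : realType} {d : measure_display} {T : measurableType d}.
Variables (P : probability T R) (G : set_system T) (sG : sub_sigma G).
Variables (K s : R) (E S : set T) (rho rho_ X : T -> R).
Hypotheses (K1 : 1 <= K) (s0 : 0 <= s) (GE : G E) (mS : measurable S)
  (rho0 : forall x, 0 < rho x) (rho_0 : forall x, 0 < rho_ x)
  (mrho : measurable_fun [set: T] rho)
  (crho : cexp P G rho rho_)
  (sparse : forall B, G B -> B `<=` E -> (P B <= K%:E * P (B `&` S))%E).

Let K0 : 0 < K. Proof. exact: lt_le_trans K1. Qed.

Let K20 : 0 < 2 * K. Proof. by rewrite mulr_gt0. Qed.

Let mrho_ : measurable_fun [set: T] rho_.
Proof. by apply: (meas_wrt_measurable sG); case: crho. Qed.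

(** The threshold [2 K] gives [Bad] conditional probability at most [1 / (2 K)], half of what
    sparsity guarantees for [S]. *)
Let Bad := [set x | 2 * K * rho_ x < rho x].

Let mBad : measurable Bad.
Proof.
rewrite -[Bad]setTI (_ : _ `&` _ =
    [set: T] `&` (fun x => 2 * K * rho_ x < rho x) @^-1` [set true]).
  by apply: measurable_fun_ltr => //; apply: measurable_funM.
by apply/seteqP; split => x [? ?]; split.
Qed.

(* Chebyshev's inequality conditional on [G]. *)
Lemma measure_bad_le B : G B -> (P (B `&` Bad) <= (2 * K)^-1%:E * P B)%E.
Proof.
move=> GB; have mB := sG.2 _ GB.
have mV : meas_wrt G (fun x => \1_B x / rho_ x).
  by apply: measurable_fun_divr => //; [exact: meas_wrt_indic|case: crho].
have V0 x : 0 <= \1_B x / rho_ x by rewrite divr_ge0// ltW.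
have mVT := meas_wrt_measurable sG mV.
have K2V0 : 0 <= (2 * K)^-1 by rewrite invr_ge0 ltW.
rewrite [leLHS]measure_integral_indic; last exact: measurableI.
apply: (@le_trans _ _ (\int[P]_x ((2 * K)^-1 * (\1_B x / rho_ x * rho x))%:E)%E).
  apply: ge0_le_integral => //.
  - by apply/measurable_EFinP; apply: measurable_indic; exact: measurableI.
  - by apply/measurable_EFinP; do 2 apply: measurable_funM => //.
  - move=> x _; rewrite lee_fin !indicE in_setI.
    case: (x \in B) => /=; last by rewrite !mul0r mulr0.
    case: (boolP (x \in Bad)) => /=; last first.
      by move=> _; apply: mulr_ge0 => //; apply: mulr_ge0; rewrite ?mul1r ?invr_ge0 ltW.
    rewrite inE /Bad/= mul1r => /ltW h.
    rewrite -[leLHS](@mulVf _ (2 * K)) ?gt_eqF// ler_wpM2l//.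
    by rewrite [leRHS]mulrC ler_pdivlMr.
under eq_integral do rewrite EFinM.
rewrite ge0_integralZl//; last 2 first.
- by apply/measurable_EFinP; apply: measurable_funM.
- by move=> x _; rewrite lee_fin mulr_ge0// ltW.
apply: lee_wpmul2l; first by rewrite lee_fin.
(* Conditioning turns [rho] into [rho_], which cancels the denominator and leaves the indicator of
   [B]. *)
rewrite (@cexp_pull_out _ _ _ P G _ rho rho_)//; last 2 first.
- by move=> x; exact: ltW.
- by move=> x; exact: ltW.
rewrite [leRHS]measure_integral_indic//.
rewrite le_eqVlt; apply/orP; left; apply/eqP; apply: eq_integral => x _.
by rewrite divfK// gt_eqF.
Qed.

(** By sparsity, [P B] is at most [K] times the measure of the part of [B] in [S] off [Bad], plus
    [K] times that of the part in [Bad]. The last term is at most half of [P B] and is absorbed,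
    which doubles the constant. *)
Lemma sparse_good B : G B -> B `<=` E ->
  (P B <= (2 * K)%:E * P (B `&` (S `\` Bad)))%E.
Proof.
move=> GB BE; have mB := sG.2 _ GB.
have mBS : measurable (B `&` (S `\` Bad)) by apply: measurableI => //; exact: measurableD.
rewrite EFinM -muleA; apply: absorb_half => //.
  by rewrite ltey_eq fin_num_measure.
apply: (le_trans (sparse GB BE)).
apply: (@le_trans _ _ (K%:E * (P (B `&` (S `\` Bad)) + P (B `&` Bad)))%E).
  apply: lee_wpmul2l; first by rewrite lee_fin ltW.
  rewrite -(setIC Bad) (le_trans _ (measureU2 _ _ _))//; last exact: measurableI.
  apply: le_measure; rewrite ?inE//; first exact: measurableI.
    by apply: measurableU => //; exact: measurableI.
  move=> x [Bx Sx]; have [bad|good] := pselect (Bad x); first by right.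
  by left; split.
rewrite muleDr// ?ge0_adde_def// ?inE//; apply: leeD => //.
apply: (@le_trans _ _ (K%:E * ((2 * K)^-1%:E * P B))%E).
  by apply: lee_wpmul2l; [rewrite lee_fin ltW|exact: measure_bad_le].
rewrite muleA -EFinM; apply: lee_wpmul2r => //; rewrite lee_fin.
by rewrite invfM mulrCA divff ?mulr1// gt_eqF.
Qed.

(** The function [X rho_^(-s)] is measurable for [G], so [sparse_good] passes to integrals with a
    factor [2 K]. Off [Bad] one has [rho <= 2 K rho_], and replacing [rho_^(-s)] by [rho^(-s)] costs
    [(2 K)^s]. *)
Lemma sparse_transfer : meas_wrt G X -> (forall x, 0 <= X x) ->
  (\int[P]_x (X x * rho_ x `^ (- s) * \1_E x)%:E <=
    ((2 * K) `^ (1 + s))%:E * \int[P]_x (X x * rho x `^ (- s) * \1_S x)%:E)%E.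
Proof.
move=> mX X0; have mXT := meas_wrt_measurable sG mX.
have mE := sG.2 _ GE.
have mSB : measurable (S `\` Bad) by exact: measurableD.
have mr_ : measurable_fun [set: T] (fun x => rho_ x `^ (- s)) by exact: measurable_fun_powR.
have mr : measurable_fun [set: T] (fun x => rho x `^ (- s)) by exact: measurable_fun_powR.
have mind (A : set T) : measurable A -> measurable_fun [set: T] (\1_A : T -> R).
  by move=> mA; exact: measurable_indic.
apply: (@le_trans _ _
    (\int[P]_x (X x * rho_ x `^ (- s) * (2 * K * \1_(S `\` Bad) x))%:E)%E).
  apply: (le_integral_meas_wrt sG) => //.
  - apply: measurable_funM => //; apply: measurable_fun_powR.
    by case: crho.
  - by move=> x; rewrite mulr_ge0 ?powR_ge0.
  - by apply: measurable_funM => //; exact: mind.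
  - by move=> x; rewrite mulr_ge0// ltW.
  - move=> A GA; have mA := sG.2 _ GA.
    under [leRHS]eq_integral do rewrite EFinM.
    rewrite ge0_integralZl//; last 2 first.
    + by apply/measurable_EFinP; apply: measurable_funTS; exact: mind.
    + by rewrite lee_fin ltW.
    rewrite !integral_indic// [E `&` A]setIC.
    have GAE : G (A `&` E) by exact: sub_sigmaI.
    apply: (le_trans (sparse_good GAE _)) => //.
    apply: lee_wpmul2l; first by rewrite lee_fin ltW.
    apply: le_measure; rewrite ?inE; [by do 2 apply: measurableI => //|exact: measurableI|].
    by move=> x [[Ax _] h].
rewrite -ge0_integralZl//; last 3 first.
- by apply/measurable_EFinP; apply: measurable_funM; [apply: measurable_funM|exact: mind].
- by move=> x _; rewrite lee_fin mulr_ge0// mulr_ge0// powR_ge0.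
- by rewrite lee_fin powR_ge0.
apply: ge0_le_integral => //.
- by move=> x _; rewrite lee_fin mulr_ge0 ?mulr_ge0 ?powR_ge0// ltW.
- apply/measurable_EFinP; apply: measurable_funM; first exact: measurable_funM.
  by apply: measurable_funM => //; exact: mind.
- apply/measurable_EFinP; apply: measurable_funM => //.
  by apply: measurable_funM; [apply: measurable_funM|exact: mind].
move=> x _; rewrite -EFinM lee_fin !indicE in_setD.
case: (x \in S) => /=; last by rewrite !mulr0.
rewrite mulr1; case: (boolP (x \in Bad)) => /=; first by rewrite !mulr0 !mulr_ge0 ?powR_ge0.
rewrite notin_setE /Bad/= => /negP; rewrite -leNgt => h.
have ab : rho_ x `^ (- s) <= (2 * K) `^ s * rho x `^ (- s).
  rewrite !powRN ler_pdivlMr ?powR_gt0// [leLHS]mulrC ler_pdivrMr ?powR_gt0//.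
  rewrite -powRM; [|exact: ltW..].
  by apply: ge0_ler_powR => //; rewrite nnegrE ?mulr_ge0 ?ltW.
rewrite powRD; last by rewrite (gt_eqF K20) implybT.
rewrite powRr1 ?(ltW K20)// !mulr1.
rewrite [leLHS](_ : _ = X x * (2 * K) * rho_ x `^ (- s)); last by ring.
rewrite [leRHS](_ : _ = X x * (2 * K) * ((2 * K) `^ s * rho x `^ (- s))); last by ring.
by apply: ler_wpM2l => //; rewrite mulr_ge0// ltW.
Qed.

End SparseTransfer.

(** * Exponent arithmetic *)

Section Exponents.
Context {R : realType}.
Implicit Types (p q nu r a b v : R).

Lemma ler_divr1 a t : 1 < t -> 0 <= a -> a / t <= a.
Proof.
move=> t1 a0; rewrite ler_pdivrMr; last exact: lt_trans t1.
by apply: ler_peMr => //; exact: ltW.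
Qed.

Lemma young_weighted q a b u v : 1 < q -> 0 <= a -> 0 <= b -> 0 <= u -> 0 <= v ->
  (a * u `^ q^-1) * (b * v `^ (q / (q - 1))^-1) <=
    a `^ q * u + b `^ (q / (q - 1)) * v.
Proof.
move=> q1 a0 b0 u0 v0; have q0 : 0 < q by lra.
set q' := q / (q - 1); have q'1 : 1 < q' by rewrite /q' ltr_pdivlMr; lra.
have q'0 : 0 < q' by lra.
have := conjugate_powR (a := a * u `^ q^-1) (b := b * v `^ q'^-1)
  (mulr_ge0 a0 (powR_ge0 _ _)) (mulr_ge0 b0 (powR_ge0 _ _)) q0 q'0
  (conj_exponentE q1).
move=> h; apply: (le_trans h).
rewrite !powRM ?powR_ge0// -!powRrM !mulVf ?gt_eqF// !powRr1//.
by apply: lerD; apply: ler_divr1 => //; rewrite mulr_ge0 ?powR_ge0.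
Qed.

Lemma exponent_gt1 nu p : 1 <= nu -> nu + 1 <= p -> 1 < p / nu.
Proof. by move=> nu1 pnu; rewrite ltr_pdivlMr; lra. Qed.

Lemma exponents_pos nu p : 1 <= nu -> nu + 1 <= p ->
  [/\ 0 < nu, 1 < p & 0 <= 1 - nu / (p - 1)].
Proof.
by move=> nu1 pnu; split; [lra|lra|rewrite subr_ge0 ler_pdivrMr; lra].
Qed.

(** Distributes [w^th] over the densities of the measures [s dP] and [w dP], with the exponents that
    Young's inequality requires. *)
Lemma dual_split nu p v : 1 <= nu -> nu + 1 <= p -> 0 < v ->
  v `^ (1 - nu / (p - 1)) =
  (v `^ (- (p - 1)^-1)) `^ (p / nu)^-1 * v `^ (p / nu / (p / nu - 1))^-1.
Proof.
move=> nu1 pnu v0; rewrite -powRrM -powRD; last by rewrite (gt_eqF v0) implybT.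
congr (_ `^ _); field.
by apply/and4P; split; apply/eqP; lra.
Qed.

(** As [s^(1-p) = v] for [s = v^(-1/(p-1))], the [L^p] norm of [f / s] for [s dP] is that of [f] for
    [v dP]. *)
Lemma dual_change p a v : 1 < p -> 0 <= a -> 0 < v ->
  (a / v `^ (- (p - 1)^-1)) `^ p * v `^ (- (p - 1)^-1) = a `^ p * v.
Proof.
move=> p1 a0 v0; rewrite powRM ?invr_ge0 ?powR_ge0// -mulrA; congr (_ * _).
rewrite -powRN opprK -powRrM -powRD; last by rewrite (gt_eqF v0) implybT.
rewrite -[RHS]powRr1 ?(ltW v0)//; congr (_ `^ _); field; apply/eqP; lra.
Qed.

Lemma dual_power r th v : 1 < r ->
  (v `^ (- (r - 1)^-1)) `^ (- ((r - 1) * th)) = v `^ th.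
Proof.
move=> r1; rewrite -powRrM; congr (_ `^ _); field; apply/eqP; lra.
Qed.

End Exponents.

Lemma integral_le_add {R : realType} {d : measure_display} {T : measurableType d}
    (P : probability T R) (z s1 s2 : T -> R) (a b : R) (B1 B2 : \bar R) :
  0 <= a -> 0 <= b -> measurable_fun [set: T] z ->
  measurable_fun [set: T] s1 -> measurable_fun [set: T] s2 ->
  (forall x, 0 <= z x) -> (forall x, 0 <= s1 x) -> (forall x, 0 <= s2 x) ->
  (forall x, z x <= a * s1 x + b * s2 x) ->
  (\int[P]_x (s1 x)%:E <= B1)%E -> (\int[P]_x (s2 x)%:E <= B2)%E ->
  (\int[P]_x (z x)%:E <= a%:E * B1 + b%:E * B2)%E.
Proof.
move=> a0 b0 mz ms1 ms2 z0 s10 s20 zle le1 le2.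
apply: (@le_trans _ _ (\int[P]_x ((a * s1 x)%:E + (b * s2 x)%:E))%E).
  apply: ge0_le_integral => //.
  - by move=> x _; rewrite lee_fin.
  - exact/measurable_EFinP.
  - under eq_fun do rewrite -EFinD.
    by apply/measurable_EFinP; apply: measurable_funD; apply: measurable_funM.
  - by move=> x _; rewrite -EFinD lee_fin.
rewrite ge0_integralD//; last 4 first.
- by move=> x _; rewrite lee_fin mulr_ge0.
- by apply/measurable_EFinP; apply: measurable_funM.
- by move=> x _; rewrite lee_fin mulr_ge0.
- by apply/measurable_EFinP; apply: measurable_funM.
under eq_integral do rewrite EFinM.
under [X in (_ + X <= _)%E]eq_integral do rewrite EFinM.
rewrite ge0_integralZl//; last 2 first.
- exact/measurable_EFinP.
- by move=> x _; rewrite lee_fin.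
rewrite ge0_integralZl//; last 2 first.
- exact/measurable_EFinP.
- by move=> x _; rewrite lee_fin.
by apply: leeD; apply: lee_wpmul2l.
Qed.

(** The first factor is the scale in Young's inequality that leaves one half in front of the term to
    absorb; the second is the loss in [sparse_transfer]. *)
Definition core_scale {R : realType} (nu p r K : R) : R :=
  let q := p / nu in let q' := q / (q - 1) in
  (2 * doob_const q') `^ q'^-1 *
  (2 * K) `^ (1 + (r - 1) * (1 - nu / (p - 1))).

(** The factor [2] comes from the absorption, the power of the scale from Young's inequality, and
    [doob_const p] from the maximal function of [f / s]. *)
Definition core_const {R : realType} (nu p r K : R) : R :=
  2 * (core_scale nu p r K `^ (p / nu) * doob_const p).

(** * The weighted estimate for a finite family *)

Section Core.
Context {R : realType} {d : measure_display} {T : measurableType d}.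
Variables (P : probability T R) (F : nat -> set_system T).
Hypotheses (sF : forall n, sub_sigma (F n))
  (ndF : forall m n, (m <= n)%N -> F m `<=` F n).
Variables (nu p r K W : R).
Hypotheses (nu1 : 1 <= nu) (pnu : nu + 1 <= p) (rp : p <= r) (K1 : 1 <= K).
Variables (w f : T -> R) (w_ sg_ rh_ f_ : nat -> T -> R).
Hypotheses (w0 : forall x, 0 < w x) (f0 : forall x, 0 <= f x)
  (wi : P.-integrable [set: T] (EFin \o w)) (mf : measurable_fun [set: T] f)
  (sgi : P.-integrable [set: T] (EFin \o dual_weight p w)).
Hypotheses (cw : forall n, cexp P (F n) w (w_ n))
  (csg : forall n, cexp P (F n) (dual_weight p w) (sg_ n))
  (crh : forall n, cexp P (F n) (dual_weight r w) (rh_ n))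
  (cf : forall n, cexp P (F n) f (f_ n)).
Hypotheses (w_0 : forall n x, 0 < w_ n x) (sg_0 : forall n x, 0 < sg_ n x)
  (rh_0 : forall n x, 0 < rh_ n x) (f_0 : forall n x, 0 <= f_ n x).

Let th := 1 - nu / (p - 1).
Let s := (r - 1) * th.
Let q := p / nu.
Let q' := q / (q - 1).

(** The form in which the characteristic of [w] enters the estimate. *)
Hypothesis hW : forall n, {ae P, forall x,
  w_ n x * sg_ n x `^ nu * rh_ n x `^ s <= W `^ nu}.

(** An index will be a pair of a step and an absolute time [lev], with [E] the level set it defines
    and [S] the part of [S_i] in it. *)
Variables (I : finType) (lev : I -> nat) (N : nat) (E S : I -> set T).
Hypotheses (levN : forall i, (lev i < N)%N) (FE : forall i, F (lev i) (E i))
  (mS : forall i, measurable (S i))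
  (S1 : forall x, \sum_i \1_(S i) x <= 1 :> R)
  (sparse : forall i B, F (lev i) B -> B `<=` E i ->
    (P B <= K%:E * P (B `&` S i))%E).

Let Phi x := \sum_i f_ (lev i) x `^ nu * \1_(E i) x.
Let sg := dual_weight p w.
Let rh := dual_weight r w.

Let p1 : 1 < p. Proof. by case: (exponents_pos nu1 pnu). Qed.
Let r1 : 1 < r. Proof. exact: lt_le_trans rp. Qed.
Let nu0 : 0 < nu. Proof. by case: (exponents_pos nu1 pnu). Qed.
Let th0 : 0 <= th. Proof. by case: (exponents_pos nu1 pnu). Qed.
Let s0 : 0 <= s. Proof. by rewrite mulr_ge0// subr_ge0 ltW. Qed.
Let q1 : 1 < q. Proof. exact: exponent_gt1. Qed.
Let q10 : 0 < q - 1. Proof. by rewrite subr_gt0. Qed.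
Let q0 : 0 < q. Proof. exact: lt_trans q1. Qed.
Let q'1 : 1 < q'. Proof. by rewrite /q' ltr_pdivlMr// mul1r ltrBlDr ltrDl. Qed.
Let q'0 : 0 < q'. Proof. exact: lt_trans q'1. Qed.

Let mw : measurable_fun [set: T] w.
Proof. by apply/measurable_EFinP; exact: measurable_int wi. Qed.
Let msg : measurable_fun [set: T] sg. Proof. exact: measurable_fun_powR. Qed.
Let mrh : measurable_fun [set: T] rh. Proof. exact: measurable_fun_powR. Qed.
Let sg0 x : 0 < sg x. Proof. exact: powR_gt0. Qed.
Let rh0 x : 0 < rh x. Proof. exact: powR_gt0. Qed.

Let mf_ n : measurable_fun [set: T] (f_ n).
Proof. by apply: (meas_wrt_measurable (sF n)); case: (cf n). Qed.
Let mw_ n : measurable_fun [set: T] (w_ n).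
Proof. by apply: (meas_wrt_measurable (sF n)); case: (cw n). Qed.
Let msg_ n : measurable_fun [set: T] (sg_ n).
Proof. by apply: (meas_wrt_measurable (sF n)); case: (csg n). Qed.
Let mrh_ n : measurable_fun [set: T] (rh_ n).
Proof. by apply: (meas_wrt_measurable (sF n)); case: (crh n). Qed.
Let mE i : measurable (E i). Proof. exact: (sF (lev i)).2. Qed.
Let mind (A : set T) : measurable A -> measurable_fun [set: T] (\1_A : T -> R).
Proof. by move=> mA; exact: measurable_indic. Qed.

Let c := (2 * K) `^ (1 + s).
Let m x := running_max (fun k => f_ k x / sg_ k x) N.

Let mm : measurable_fun [set: T] m.
Proof.
by apply: measurable_fun_running_max => k _; exact: measurable_fun_divr.
Qed.

Let m0 x : 0 <= m x. Proof. exact: running_max_ge0. Qed.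

(** Condition [gw], insert the characteristic, move from [E i] to [S i] with [rho = rh], then bound
    the ratios by maximal functions. The result depends on [i] only through the indicator of [S i],
    so it can be summed. *)
Lemma core_term i (gw : T -> R) (gw_ : nat -> T -> R) :
  measurable_fun [set: T] gw -> (forall x, 0 <= gw x) ->
  (forall n x, 0 <= gw_ n x) -> (forall n, cexp P (F n) gw (gw_ n)) ->
  (\int[P]_x (f_ (lev i) x `^ nu * \1_(E i) x * gw x)%:E <=
   \int[P]_x (c * W `^ nu * (m x `^ nu * running_max (fun k => gw_ k x / w_ k x) N
     * w x `^ th) * \1_(S i) x)%:E)%E.
Proof.
move=> mgw gw0 gw_0 cgw; set n := lev i.
have mgw_ k : measurable_fun [set: T] (gw_ k).
  by apply: (meas_wrt_measurable (sF k)); case: (cgw k).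
pose Y x := (f_ n x / sg_ n x) `^ nu * (gw_ n x / w_ n x).
have Y0 x : 0 <= Y x by rewrite mulr_ge0 ?powR_ge0// divr_ge0// ltW.
have mY : meas_wrt (F n) Y.
  have [h1 _ _] := cf n; have [h2 _ _] := csg n.
  have [h3 _ _] := cgw n; have [h4 _ _] := cw n.
  apply: measurable_funM; last exact: measurable_fun_divr.
  by apply: measurable_fun_powR; exact: measurable_fun_divr.
have mYT := meas_wrt_measurable (sF n) mY.
rewrite (@cexp_pull_out _ _ _ P (F n) _ gw (gw_ n))//; last 2 first.
- apply: measurable_funM; last exact: (meas_wrt_indic (sF n) (FE i)).
  by apply: measurable_fun_powR; case: (cf n).
- by move=> x; rewrite mulr_ge0 ?powR_ge0.
apply: (@le_trans _ _
    (\int[P]_x (W `^ nu * (Y x * rh_ n x `^ (- s) * \1_(E i) x))%:E)%E).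
  apply: ae_ge0_le_integral => //.
  - by move=> x _; rewrite lee_fin mulr_ge0// mulr_ge0 ?powR_ge0.
  - apply/measurable_EFinP; apply: measurable_funM => //.
    by apply: measurable_funM; [exact: measurable_fun_powR|exact: mind].
  - by move=> x _; rewrite lee_fin mulr_ge0 ?powR_ge0// mulr_ge0// mulr_ge0 ?powR_ge0.
  - apply/measurable_EFinP; apply: measurable_funM => //.
    apply: measurable_funM; last exact: mind.
    by apply: measurable_funM => //; exact: measurable_fun_powR.
  - apply: filterS (hW n) => x hx _; rewrite lee_fin.
    rewrite mulrAC mulrA; apply: ler_wpM2r => //.
    have wn := w_0 n x; have sn := sg_0 n x; have rn := rh_0 n x.
    (* The first three factors on the right are those bounded by [W^nu]; the leftover [rh_^(-s)] is
       what [sparse_transfer] handles. *)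
    have -> : f_ n x `^ nu * gw_ n x =
        w_ n x * sg_ n x `^ nu * rh_ n x `^ s * (Y x * rh_ n x `^ (- s)).
      rewrite /Y powRM ?invr_ge0 ?(ltW sn)// powRN -[(sg_ n x)^-1]powR_inv1 ?(ltW sn)//.
      rewrite powRAC powR_inv1 ?powR_ge0//; field.
      by rewrite !gt_eqF ?powR_gt0.
    by apply: ler_wpM2r => //; rewrite mulr_ge0 ?powR_ge0.
under eq_integral do rewrite EFinM.
rewrite ge0_integralZl//; last 3 first.
- apply/measurable_EFinP; apply: measurable_funM; last exact: mind.
  by apply: measurable_funM => //; exact: measurable_fun_powR.
- by move=> x _; rewrite lee_fin mulr_ge0// mulr_ge0 ?powR_ge0.
- by rewrite lee_fin powR_ge0.
apply: (@le_trans _ _ ((W `^ nu)%:E * (c%:E *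
    \int[P]_x (Y x * rh x `^ (- s) * \1_(S i) x)%:E))%E).
  apply: lee_wpmul2l; first by rewrite lee_fin powR_ge0.
  exact: (sparse_transfer (sF n) K1 s0 (FE i) (mS i) rh0 (rh_0 n) mrh (crh n)
    (@sparse i)).
rewrite muleA -EFinM -ge0_integralZl//; last 3 first.
- apply/measurable_EFinP; apply: measurable_funM; last exact: mind.
  by apply: measurable_funM => //; exact: measurable_fun_powR.
- by move=> x _; rewrite lee_fin mulr_ge0// mulr_ge0 ?powR_ge0.
- by rewrite lee_fin mulr_ge0 ?powR_ge0.
apply: ge0_le_integral => //.
- move=> x _; rewrite -EFinM lee_fin; apply: mulr_ge0; first by rewrite mulr_ge0 ?powR_ge0.
  by rewrite mulr_ge0// mulr_ge0 ?powR_ge0.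
- apply/measurable_EFinP; apply: measurable_funM => //.
  apply: measurable_funM; last exact: mind.
  by apply: measurable_funM => //; exact: measurable_fun_powR.
- apply/measurable_EFinP; apply: measurable_funM; last exact: mind.
  apply: measurable_funM => //; apply: measurable_funM; last exact: measurable_fun_powR.
  apply: measurable_funM; first exact: measurable_fun_powR.
  by apply: measurable_fun_running_max => k _; exact: measurable_fun_divr.
move=> x _; rewrite -EFinM lee_fin [c * _]mulrC [leLHS]mulrA; apply: ler_wpM2r => //.
apply: ler_wpM2l; first by rewrite mulr_ge0 ?powR_ge0.
rewrite /rh /dual_weight /s dual_power//.
apply: ler_wpM2r; first exact: powR_ge0.
rewrite /Y.
have fs : f_ n x / sg_ n x <= m x.
  exact: (@le_running_max _ N n (fun k => f_ k x / sg_ k x) (levN i)).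
apply: ler_pM.
- exact: powR_ge0.
- by rewrite divr_ge0// ltW.
- apply: ge0_ler_powR => //; rewrite ?nnegrE//; first exact: ltW.
  by rewrite divr_ge0// ltW.
- exact: (@le_running_max _ N n (fun k => gw_ k x / w_ k x) (levN i)).
Qed.

Let D' := doob_const q'.
Let D'0 : 0 < D'.
Proof.
rewrite /D' /doob_const mulr_gt0// powR_gt0// mulr_gt0// divr_gt0//.
by rewrite subr_gt0.
Qed.
(** Chosen so that [lam^(-q') D' = 1/2]. *)
Let lam := (2 * D') `^ q'^-1.
Let lam0 : 0 < lam. Proof. by rewrite powR_gt0// mulr_gt0. Qed.

Let mPhi : measurable_fun [set: T] Phi.
Proof.
apply: measurable_sum => i; apply: measurable_funM; last exact: mind.
exact: measurable_fun_powR.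
Qed.

Let Phi0 x : 0 <= Phi x.
Proof. by apply: sumr_ge0 => i _; rewrite mulr_ge0 ?powR_ge0. Qed.

(* The truncation at [L] makes the left-hand side finite, as absorption needs. *)
Lemma core_bound (L : R) : 0 <= L ->
  (\int[P]_x (Num.min L (Phi x) `^ q * w x)%:E <=
    (core_const nu p r K * W `^ p)%:E * \int[P]_x (f x `^ p * w x)%:E)%E.
Proof.
move=> L0; pose PhiL x := Num.min L (Phi x).
have PhiL0 x : 0 <= PhiL x by rewrite le_min L0/=.
have mPhiL : measurable_fun [set: T] PhiL by exact: measurable_minr.
(* With this power, [(gw / w)^q'] is [PhiL^q], so Doob's inequality for [w dP] returns the left-hand
   side. *)
pose gw x := PhiL x `^ (q - 1) * w x.
have gw0 x : 0 <= gw x by rewrite mulr_ge0 ?powR_ge0// ltW.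
have mgw : measurable_fun [set: T] gw.
  by apply: measurable_funM => //; exact: measurable_fun_powR.
have trunc_int t : 0 <= t ->
    (\int[P]_x (PhiL x `^ t * w x)%:E < +oo)%E.
  move=> t0; apply: (@le_lt_trans _ _ (\int[P]_x (L `^ t * w x)%:E)%E).
    apply: ge0_le_integral => //.
    - by move=> x _; rewrite lee_fin mulr_ge0 ?powR_ge0// ltW.
    - apply/measurable_EFinP; apply: measurable_funM => //.
      exact: measurable_fun_powR.
    - by apply/measurable_EFinP; apply: measurable_funM.
    - move=> x _; rewrite lee_fin; apply: ler_wpM2r; first exact: ltW.
      apply: ge0_ler_powR => //; rewrite ?nnegrE ?PhiL0//.
      by rewrite /PhiL ge_min lexx.
  under eq_integral do rewrite EFinM.
  rewrite ge0_integralZl//; last 3 first.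
  - exact/measurable_EFinP.
  - by move=> x _; rewrite lee_fin ltW.
  - by rewrite lee_fin powR_ge0.
  rewrite lte_mul_pinfty ?lee_fin ?powR_ge0//.
  case/integrableP: wi => _; apply: le_lt_trans.
  by under [leRHS]eq_integral do rewrite /= gtr0_norm//.
have gwi : P.-integrable [set: T] (EFin \o gw).
  apply/integrableP; split; first exact/measurable_EFinP.
  under eq_integral do rewrite /= ger0_norm//.
  exact/trunc_int/ltW.
have [gw_ [cgw gw_0]] := nonneg_versions sF gwi gw0.
have mgw_ k : measurable_fun [set: T] (gw_ k).
  by apply: (meas_wrt_measurable (sF k)); case: (cgw k).
pose Gm x := running_max (fun k => gw_ k x / w_ k x) N.
have mGm : measurable_fun [set: T] Gm.
  by apply: measurable_fun_running_max => k _; exact: measurable_fun_divr.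
have Gm0 x : 0 <= Gm x by exact: running_max_ge0.
pose Z x := c * W `^ nu * (m x `^ nu * Gm x * w x `^ th).
have Z0 x : 0 <= Z x by rewrite /Z !mulr_ge0 ?powR_ge0.
have mZ : measurable_fun [set: T] Z.
  apply: measurable_funM => //; apply: measurable_funM; last exact: measurable_fun_powR.
  by apply: measurable_funM => //; exact: measurable_fun_powR.
pose I0 := (\int[P]_x (PhiL x `^ q * w x)%:E)%E.
have I0_ge0 : (0 <= I0)%E.
  by apply: integral_ge0 => x _; rewrite lee_fin mulr_ge0 ?powR_ge0// ltW.
have I0_fin : (I0 < +oo)%E by apply: trunc_int; exact: ltW.
have I0Z : (I0 <= \int[P]_x (Z x)%:E)%E.
  apply: (@le_trans _ _
      (\int[P]_x (\sum_i (f_ (lev i) x `^ nu * \1_(E i) x * gw x)%:E))%E).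
    apply: ge0_le_integral => //.
    - by move=> x _; rewrite lee_fin mulr_ge0 ?powR_ge0// ltW.
    - apply/measurable_EFinP; apply: measurable_funM => //.
      exact: measurable_fun_powR.
    - under eq_fun do rewrite sumEFin.
      apply/measurable_EFinP; apply: measurable_sum => i.
      apply: measurable_funM => //.
      by apply: measurable_funM; [exact: measurable_fun_powR|exact: mind].
    - move=> x _; rewrite sumEFin lee_fin -big_distrl/= -/(Phi x) /gw mulrA.
      apply: ler_wpM2r; first exact: ltW.
      (* One factor [PhiL] is bounded by [Phi]; the others stay in the test function. *)
      rewrite -[leLHS]mulr_powRB1//; apply: ler_wpM2r; first exact: powR_ge0.
      by rewrite /PhiL ge_min lexx orbT.
  rewrite ge0_integral_sum//; last 2 first.
  - move=> i; apply/measurable_EFinP; apply: measurable_funM => //.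
    by apply: measurable_funM; [exact: measurable_fun_powR|exact: mind].
  - by move=> i x _; rewrite lee_fin mulr_ge0// mulr_ge0 ?powR_ge0.
  apply: (@le_trans _ _ (\sum_i \int[P]_x (Z x * \1_(S i) x)%:E)%E).
    by apply: lee_sum => i _; exact: core_term.
  rewrite -ge0_integral_sum//; last 2 first.
  - by move=> i; apply/measurable_EFinP; apply: measurable_funM => //; exact: mind.
  - by move=> i x _; rewrite lee_fin mulr_ge0.
  (* By [S1] the indicators of the [S i] add up to at most [1]. *)
  apply: ge0_le_integral => //.
  - by move=> x _; rewrite sumEFin lee_fin sumr_ge0// => i _; rewrite mulr_ge0.
  - under eq_fun do rewrite sumEFin.
    apply/measurable_EFinP; apply: measurable_sum => i.
    by apply: measurable_funM => //; exact: mind.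
  - exact/measurable_EFinP.
  - move=> x _; rewrite sumEFin lee_fin -big_distrr/=.
    by rewrite -[leRHS]mulr1; apply: ler_wpM2l.
pose A := (lam * c) `^ q.
(* Young's inequality for [lam c W^nu m^nu] and [Gm / lam], with weights [sg] and [w]; the scale
   [lam] cancels in the product. *)
have ZA x : Z x <= A * W `^ p * (m x `^ p * sg x)
    + lam `^ (- q') * (Gm x `^ q' * w x).
  have := young_weighted q1 (_ : 0 <= lam * c * W `^ nu * m x `^ nu)
    (_ : 0 <= lam^-1 * Gm x) (ltW (sg0 x)) (ltW (w0 x)).
  move=> /(_ ltac:(by rewrite !mulr_ge0 ?powR_ge0// ltW)).
  move=> /(_ ltac:(by rewrite mulr_ge0// invr_ge0 ltW)).
  rewrite -/q' => h; rewrite /Z /th (dual_split nu1 pnu (w0 x)) -/q -/q' -/(sg x).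
  move: h; set a := (sg x `^ _); set b := (w x `^ _).
  have -> : lam * c * W `^ nu * m x `^ nu * a * (lam^-1 * Gm x * b) =
    c * W `^ nu * (m x `^ nu * Gm x * (a * b)).
    by field; rewrite gt_eqF.
  move=> h; apply: (le_trans h).
  have pq : nu * q = p by rewrite /q mulrCA divff ?mulr1// gt_eqF.
  rewrite !powRM ?mulr_ge0 ?powR_ge0 ?invr_ge0// ?(ltW lam0)//.
  rewrite -!(powRrM _ nu q) pq -/A.
  rewrite -powR_inv1 ?(ltW lam0)// -powRrM mulN1r.
  by rewrite /A powRM ?powR_ge0 ?(ltW lam0)// -!mulrA.
have doob1 := weighted_doob sF ndF p1 sg0 f0 sgi mf csg cf sg_0 f_0 N.
have doob2 := weighted_doob sF ndF q'1 w0 gw0 wi mgw cw cgw w_0 gw_0 N.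
have E1 : (\int[P]_x ((f x / dual_weight p w x) `^ p * dual_weight p w x)%:E
    = \int[P]_x (f x `^ p * w x)%:E)%E.
  by apply: eq_integral => x _; rewrite /dual_weight dual_change.
have E2 : (\int[P]_x ((gw x / w x) `^ q' * w x)%:E = I0)%E.
  apply: eq_integral => x _; rewrite /gw mulfK ?gt_eqF//.
  by rewrite powR_pred_conj.
rewrite -/I0 /core_const -mulrA EFinM -muleA; apply: absorb_half => //.
apply: (le_trans I0Z).
have mS1 : measurable_fun [set: T] (fun x => m x `^ p * sg x).
  by apply: measurable_funM => //; exact: measurable_fun_powR.
have mS2 : measurable_fun [set: T] (fun x => Gm x `^ q' * w x).
  by apply: measurable_funM => //; exact: measurable_fun_powR.
have S10 x : 0 <= m x `^ p * sg x by rewrite mulr_ge0 ?powR_ge0.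
have S20 x : 0 <= Gm x `^ q' * w x by rewrite mulr_ge0 ?powR_ge0// ltW.
have AW0 : 0 <= A * W `^ p by rewrite mulr_ge0 ?powR_ge0.
rewrite E1 in doob1; rewrite E2 in doob2.
have := integral_le_add AW0 (powR_ge0 lam (- q')) mZ mS1 mS2 Z0 S10 S20 ZA doob1 doob2.
(* The Doob constant for [w dP] and the power of [lam] combine to the one half that is absorbed. *)
rewrite !muleA -!EFinM (_ : lam `^ (- q') * doob_const q' = 2^-1); last first.
  rewrite /lam -powRrM mulrN mulVf ?(gt_eqF q'0)// powR_inv1; last first.
    by rewrite mulr_ge0// ltW.
  by rewrite invfM -mulrA mulVf ?mulr1// gt_eqF.
by rewrite (mulrAC A).
Qed.

End Core.

(** * Local spaces *)

Section LocalSpaces.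
Context {R : realType} {d : measure_display} {T : measurableType d}.
Variables (P : probability T R) (F : nat -> set_system T).
Hypotheses (sF : forall n, sub_sigma (F n))
  (ndF : forall m n, (m <= n)%N -> F m `<=` F n).

(* [S] lives on [D] and its filtration is [F] started at the finite time [Z]. *)
Record shifted_space (S : fspace R T) (D : set T) (Z : T -> nat) (c : R) : Prop :=
  ShiftedSpace {
    shifted_set : fs_set S = D;
    shifted_measurable : measurable D;
    shifted_sigma : forall A, fs_sigma S A <-> measurable A /\ A `<=` D;
    shifted_gt0 : 0 < c;
    shifted_meas : forall A, fs_meas S A = (c%:E * P (A `&` D))%E;
    shifted_time : forall k, F k (D `&` [set x | Z x = k]);
    shifted_filt : forall n A, fs_filt S n A <->
      [/\ A `<=` D, measurable A & forall k, F (k + n)%N (A `&` [set x | Z x = k])]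
  }.

Lemma shifted_base : shifted_space (base_space P F) [set: T] (cst 0%N) 1.
Proof.
have cst_set k : [set x : T | cst 0%N x = k] = if k == 0%N then setT else set0.
  by apply/seteqP; split => x /=; case: k.
split => //=.
- by move=> A; split => [|[]].
- by move=> A; rewrite mul1e setIT.
- move=> k; rewrite cst_set setTI; case: ifP => _; last exact: sub_sigma0.
  by rewrite (sub_sigmaE (sF k)); exact: measurableT.
- move=> n A; split => [FA|[_ _ /(_ 0%N)]]; last by rewrite cst_set setIT.
  split => //; first exact: (sF n).2.
  move=> k; rewrite cst_set; case: eqP => [->|_]; first by rewrite setIT.
  by rewrite setI0; exact: sub_sigma0.
Qed.

Variables (S : fspace R T) (D : set T) (Z : T -> nat) (c : R) (tau : T -> option nat).
Hypotheses (shS : shifted_space S D Z c) (stau : is_stopping_time S tau).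

Let E := time_fin S tau.
(** The absolute time of [tau], counted in [F]; the default [0] is met only where [tau] is
    infinite. *)
Let Z' x := (Z x + odflt 0 (tau x))%N.
Let H j k := [set x | [/\ D x, tau x = Some j & Z x = k]].

Let FH j k : F (k + j)%N (H j k).
Proof.
have [_ _ /(_ k)] := (shifted_filt shS j _).1 (stau j).
congr (F _ _); apply/seteqP; split => x /=.
- by rewrite /time_eq (shifted_set shS) => -[[]].
- by rewrite /time_eq (shifted_set shS) => -[].
Qed.

Let EH k x : (E `&` [set x | Z' x = k]) x <->
  exists2 j, (j <= k)%N & H j (k - j) x.
Proof.
rewrite /E /time_fin (shifted_set shS) /Z' /H /=; split.
- move=> [[Dx]]; case: (tau x) => // j _ /= <-; exists j.
    by rewrite leq_addl.
  by split => //; rewrite addnK.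
- move=> [j jk [Dx tx Zx]]; rewrite tx Zx; split; first by split.
  by rewrite /= subnK.
Qed.

Let E_sub : E `<=` D.
Proof. by rewrite /E /time_fin (shifted_set shS) => x []. Qed.

(** Split according to [tau = j] and [Z = k - j]. On such a piece [tau + n <= j + n], so [A] is seen
    by the local filtration at [j + n], that is by [F] at [(k - j) + (j + n) = k + n]. *)
Lemma shifted_stopped n A : stopped_sigma S (time_shift tau n) A ->
  forall k, F (k + n)%N (A `&` E `&` [set x | Z' x = k]).
Proof.
move=> [sA fA] k.
pose B j := if (j <= k)%N then A `&` H j (k - j) else set0.
rewrite (_ : _ `&` _ = \bigcup_j B j).
  apply: sub_sigma_bigcup => // j; rewrite /B; case: ifPn => jk; last exact: sub_sigma0.
  have [_ _ /(_ (k - j)%N)] := (shifted_filt shS _ _).1 (fA (j + n)%N).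
  rewrite addnA subnK// => FA.
  have FHk : F (k + n)%N (H j (k - j)).
    by apply: (ndF (leq_addr n k)); have := FH j (k - j); rewrite subnK.
  have := sub_sigmaI (sF _) FA FHk; congr (F _ _).
  apply/seteqP; split => x /=; first by move=> [[[Ax _] _] Hx].
  move=> [Ax Hx]; split => //; case: Hx => Dx tx Zx; split => //; split => //.
  rewrite /time_le (shifted_set shS); split => //=; exists (j + n)%N => //.
  by rewrite /time_shift tx.
apply/seteqP; split => x.
- move=> [[Ax Ex] Zx]; have /EH[j jk Hx] : (E `&` [set x | Z' x = k]) x by [].
  by exists j => //; rewrite /B jk.
- move=> [j _]; rewrite /B; case: ifPn => // jk [Ax Hx].
  have [Ex Zx] : (E `&` [set x | Z' x = k]) x by apply/EH; exists j.
  by [].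
Qed.

(** Conversely, only the values [j] of [tau] with [j + n <= m] matter. There [Z = k] means
    [Z' = k + j], and the index [k + j + n] is at most [k + m]. *)
Lemma shifted_stoppedV n A : A `<=` E -> measurable A ->
  (forall k, F (k + n)%N (A `&` [set x | Z' x = k])) ->
  stopped_sigma S (time_shift tau n) A.
Proof.
move=> AE mA FA; split.
  by apply/(shifted_sigma shS); split => //; exact: subset_trans E_sub.
move=> m; set L := A `&` time_le _ _ _.
have FL k : F (k + m)%N (L `&` [set x | Z x = k]).
  pose B j := if (j + n <= m)%N then A `&` [set x | Z' x = (k + j)%N] `&` H j k
              else set0.
  rewrite (_ : _ `&` _ = \bigcup_j B j).
    apply: sub_sigma_bigcup => // j; rewrite /B; case: ifPn => jm; last exact: sub_sigma0.
    apply: sub_sigmaI => //.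
      by apply: (ndF _ (FA (k + j)%N)); rewrite -addnA leq_add2l.
    apply: (ndF _ (FH j k)); rewrite leq_add2l.
    by apply: leq_trans jm; rewrite leq_addr.
  apply/seteqP; split => x.
  - move=> [[Ax [Dx [l /=]]]]; rewrite /time_shift.
    case tx: (tau x) => [j|//] /= [<-] jm Zx; exists j => //; rewrite /B jm.
    rewrite (shifted_set shS) in Dx.
    by split; [split => //=; rewrite /Z' Zx tx|split].
  - move=> [j _]; rewrite /B; case: ifPn => // jm [[Ax _] [Dx tx Zx]].
    split => //; split => //; split; first by rewrite (shifted_set shS).
    by exists (j + n)%N => //; rewrite /time_shift tx.
apply/(shifted_filt shS); split => //.
- by move=> x [Ax _]; apply/E_sub/AE.
- rewrite (_ : L = \bigcup_k (L `&` [set x | Z x = k])).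
    by apply: bigcupT_measurable => k; exact: (sF _).2 (FL k).
  apply/seteqP; split => x; first by move=> Lx; exists (Z x).
  by move=> [k _ []].
Qed.

Lemma shifted_fin_time k : F k (E `&` [set x | Z' x = k]).
Proof.
pose B j := if (j <= k)%N then H j (k - j) else set0.
rewrite (_ : _ `&` _ = \bigcup_j B j).
  apply: sub_sigma_bigcup => // j; rewrite /B; case: ifPn => jk; last exact: sub_sigma0.
  by have := FH j (k - j); rewrite subnK.
apply/seteqP; split => x.
- by move=> /EH[j jk Hx]; exists j => //; rewrite /B jk.
- by move=> [j _]; rewrite /B; case: ifPn => // jk Hx; apply/EH; exists j.
Qed.

Lemma shifted_fin_measurable : measurable E.
Proof.
rewrite (_ : E = \bigcup_k (E `&` [set x | Z' x = k])).
  by apply: bigcupT_measurable => k; exact: (sF _).2 (shifted_fin_time k).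
by apply/seteqP; split => x; [move=> Ex; exists (Z' x)|move=> [k _ []]].
Qed.

(** Restarting at [tau] preserves the structure, with [E] for [D] and the absolute time [Z'] for
    [Z], so that iterated spaces can be treated by induction. *)
Lemma shifted_local : (0 < fs_meas S E)%E ->
  exists c', shifted_space (local_space S tau) E Z' c'.
Proof.
move=> E0; rewrite /local_space -/E E0.
have EDE : E `&` D = E by apply/setIidl.
have fin : fs_meas S E \is a fin_num.
  rewrite (shifted_meas shS) EDE fin_numM// fin_num_measure//.
  exact: shifted_fin_measurable.
have f0 : 0 < fine (fs_meas S E) by rewrite fine_gt0// E0/= ltey_eq fin.
exists (c * (fine (fs_meas S E))^-1); split => //=.
- exact: shifted_fin_measurable.
- move=> A; split.
  + move=> [B /(shifted_sigma shS)[mB BD] <-]; split; last by move=> x [].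
    by apply: measurableI => //; exact: shifted_fin_measurable.
  + move=> [mA AE]; exists A; last exact/setIidl.
    by apply/(shifted_sigma shS); split => //; exact: subset_trans E_sub.
- by rewrite mulr_gt0 ?invr_gt0// (shifted_gt0 shS).
- move=> A; rewrite (shifted_meas shS) -setIA EDE muleAC -EFinM//.
- exact: shifted_fin_time.
- move=> n A; split.
  + move=> [B sB <-]; split.
    * by move=> x [].
    * apply: measurableI; last exact: shifted_fin_measurable.
      by case: sB => /(shifted_sigma shS)[].
    * exact: shifted_stopped.
  + move=> [AE mA FA]; exists A; last exact/setIidl.
    exact: shifted_stoppedV.
Qed.

Lemma time_shift0 (t : T -> option nat) : time_shift t 0 = t.
Proof. by apply/funext => x; rewrite /time_shift; case: (t x) => //= k; rewrite addn0. Qed.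

End LocalSpaces.

Lemma pmuleBr {R : realType} (c : R) (a b : \bar R) : 0 < c ->
  (c%:E * (a - b) = c%:E * a - c%:E * b)%E.
Proof.
move=> c0; case: a => [a| |]; case: b => [b| |];
  first by rewrite muleBr.
all: by rewrite /= ?gt0_muley ?gt0_muleNy ?lte_fin.
Qed.

(** * Conditional expectations on local spaces *)

Section LocalConditioning.
Context {R : realType} {d : measure_display} {T : measurableType d}.
Variables (P : probability T R) (F : nat -> set_system T).
Hypotheses (sF : forall n, sub_sigma (F n))
  (ndF : forall m n, (m <= n)%N -> F m `<=` F n).
Variables (S : fspace R T) (D : set T) (Z : T -> nat) (c : R) (tau : T -> option nat).
Hypotheses (shS : shifted_space P F S D Z c) (stau : is_stopping_time S tau).

Lemma shifted_integral A (g : T -> \bar R) : measurable A -> A `<=` D ->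
  measurable_fun A g ->
  (\int[fs_meas S]_(x in A) g x = c%:E * \int[P]_(x in A) g x)%E.
Proof.
move=> mA AD mg; have c0 := shifted_gt0 shS.
pose cn : {nonneg R} := NngNum (ltW c0).
have -> : fs_meas S = mscale cn (mrestr P (shifted_measurable shS)).
  by apply/funext => B; rewrite (shifted_meas shS).
rewrite (@eq_measure_integral _ _ _ A (mscale cn P)); last first.
  by move=> B mB BA; rewrite /= /mscale /= /mrestr setIidl//; exact: subset_trans AD.
rewrite integralE [in RHS]integralE !ge0_integral_mscale//=; last 2 first.
- exact: measurable_funeneg.
- exact: measurable_funepos.
exact/esym/pmuleBr.
Qed.

Let E := time_fin S tau.
Let Z' x := (Z x + odflt 0 (tau x))%N.
Let G := stopped_sigma S tau.

(* Only an upper bound is claimed: [cond_exp] is the default [0] if no version of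
   the conditional expectation exists. *)
Lemma cond_exp_stopped_le (f : T -> R) (f_ : nat -> T -> R) :
  measurable_fun [set: T] f ->
  (forall k, cexp P (F k) f (f_ k)) -> (forall k x, 0 <= f_ k x) ->
  measurable_fun E (cond_exp S G f) /\
  forall k, {ae P, forall x, (E `&` [set x | Z' x = k]) x ->
    0 <= cond_exp S G f x <= f_ k x}.
Proof.
move=> mf cf f_0; rewrite /cond_exp; set A0 := [set _ | _].
have [A0g|A0N] := pselect (exists g, A0 g); last first.
  rewrite xgetPN; last by move=> g A0g; apply: A0N; exists g.
  split; first exact: measurable_cst.
  by move=> k; apply: aeW => x _; rewrite lexx f_0.
have [] := xgetPex (cst 0) A0g; set g := xget _ _ => mg _ gE.
have ED : E `<=` D by rewrite /E /time_fin (shifted_set shS) => x [].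
have mE : measurable E := shifted_fin_measurable sF shS stau.
have Gg (B : set R) : measurable B -> G (D `&` g @^-1` B).
  by move=> mB; apply: mg; exists B => //; rewrite (shifted_set shS).
have GF A k : G A -> F k (A `&` E `&` [set x | Z' x = k]).
  move=> GA; rewrite -[X in F X](addn0 k).
  by apply: (shifted_stopped sF ndF shS stau); rewrite time_shift0.
have mgD : measurable_fun D g.
  by move=> _ B mB; have [/(shifted_sigma shS)[]] := Gg B mB.
split; first exact: (measurable_funS (shifted_measurable shS) _ mgD).
move=> k; pose Ek := E `&` [set x | Z' x = k].
have FEk : F k Ek by exact: (shifted_fin_time sF shS stau k).
have mEk : measurable (Ek : set (g_sigma_algebraType (F k))).
  by rewrite -sub_sigmaE.
(* Sets of [G] cut down to [Ek] lie in [F k], so this restriction is measurable for [F k]. *)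
pose h := g \_ Ek.
have mh : meas_wrt (F k) h.
  apply/(measurable_restrictT _ mEk) => _ B mB.
  rewrite -sub_sigmaE//; have := GF _ k (Gg B mB); congr (F _ _).
  apply/seteqP; split => x; first by move=> [[[Dx gx] Ex] Zx].
  by move=> [[Ex Zx] gx]; split => //; split => //; split => //; exact: ED.
have [mfk fki fkE] := cf k.
have : {ae P, forall x, Ek x -> h x = f_ k x}.
  apply: (ae_eq_on_meas_wrt (sF k) FEk mh mfk fki) => A FA AEk.
  have mA := (sF k).2 _ FA.
  have AE : A `<=` E by move=> x /AEk[].
  have AD : A `<=` D := subset_trans AE ED.
  (* Conversely, a set of [F k] inside [Ek] belongs to [G], so both conditional expectations have
     the integral of [f] over it, up to the factor [c], which cancels. *)
  have GA : G A.
    rewrite /G -(time_shift0 tau); apply: (shifted_stoppedV sF ndF shS stau) => //.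
    move=> j; rewrite addn0; have [<-|kj] := eqVneq k j.
      by rewrite setIidl// => x /AEk[].
    rewrite (_ : _ `&` _ = set0); first exact: sub_sigma0.
    apply/seteqP; split => x //= -[/AEk[_ /= Zk] Zj].
    by move: kj; rewrite -Zk -Zj eqxx.
  have cn0 : c%:E != 0%E by rewrite eqe (gt_eqF (shifted_gt0 shS)).
  have : (c%:E * \int[P]_(x in A) (g x)%:E = c%:E * \int[P]_(x in A) (f x)%:E)%E.
    rewrite -!shifted_integral//; first exact: gE.
    - by apply/measurable_EFinP; exact: measurable_funTS.
    - by apply/measurable_EFinP; exact: (measurable_funS (shifted_measurable shS) _ mgD).
  move=> /(congr1 (fun y => (c^-1)%:E * y)%E).
  rewrite !muleA -!EFinM mulVf ?gt_eqF ?(shifted_gt0 shS)// !mul1e => gf.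
  rewrite fkE// -gf; apply: eq_integral => x; rewrite inE => Ax.
  by rewrite /h patchE mem_set//; exact: AEk.
apply: filterS => x hx Ex; have := hx Ex.
by rewrite /h patchE mem_set// => ->; rewrite f_0 lexx.
Qed.

End LocalConditioning.

(** * Levels of a conditionally sparse sequence *)

Section SparseLevels.
Context {R : realType} {d : measure_display} {T : measurableType d}.
Variables (P : probability T R) (F : nat -> set_system T).
Variables (tau : nat -> T -> option nat) (K : R).
Hypotheses (cP : measure_is_complete P) (sF : forall n, sub_sigma (F n))
  (ndF : forall m n, (m <= n)%N -> F m `<=` F n) (K1 : 1 <= K)
  (sp : conditionally_sparse P F tau K).

Local Notation Om i := (iter_space P F tau i).
Local Notation Ei i := (Eset P F tau i).

(** If [E_i] has positive measure, the next space lives on it; otherwise the space is unchanged and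
    the next time coincides with [tau i]. *)
Lemma Eset_succ i : Ei i.+1 `<=` Ei i.
Proof.
have [_ /(_ i) + _] := sp; rewrite /is_filter_shifted /Eset /= /local_space.
case: ifPn => [E0 _ x [] //|E0 h x [Dx tx]]; split => //.
by move: tx; rewrite /= h// inE.
Qed.

Lemma Eset_le i j : (i <= j)%N -> Ei j `<=` Ei i.
Proof.
move=> /subnK <-; elim: (j - i)%N => // n ih.
by rewrite addSn; apply: subset_trans ih; exact: Eset_succ.
Qed.

Lemma shifted_iter i :
  (forall j, (j < i)%N -> (0 < fs_meas (Om j) (Ei j))%E) ->
  (exists D Z c, shifted_space P F (Om i) D Z c) /\ is_stopping_time (Om i) (tau i).
Proof.
have [t0 ft _] := sp; elim: i => [|i ih] pos.
  split; first by exists setT, (cst 0%N), 1; exact: shifted_base.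
  move=> n; rewrite t0; case: n => [|n].
    rewrite (_ : time_eq _ _ _ = setT); last by apply/seteqP; split.
    suff : F 0%N setT by []; rewrite (sub_sigmaE (sF 0%N)); exact: measurableT.
  rewrite (_ : time_eq _ _ _ = set0); first exact: (sub_sigma0 (sF n.+1)).
  by apply/seteqP; split => x // -[].
have [[D [Z [c sh]]] st] := ih (fun j ji => pos j (ltnW ji)).
have Ei0 := pos i (ltnSn i).
split; last by have := ft i; rewrite /is_filter_shifted Ei0.
have [c' sh'] := shifted_local sF ndF sh st Ei0.
by exists (Ei i), (fun x => (Z x + odflt 0 (tau i x))%N), c'.
Qed.

(** While this holds, [local_space] has not taken its degenerate branch; once it fails, [E_i] is
    null. *)
Let good i := forall j, (j <= i)%N -> (0 < fs_meas (Om j) (Ei j))%E.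

(** At the first failing index the space is still a shifted one, whose measure is a positive
    multiple of [P], so its [E_i] is null for [P]. All later ones are contained in it. *)
Lemma Eset_negligible i : ~ good i -> P.-negligible (Ei i).
Proof.
elim/ltn_ind: i => i ih ngood.
have [[j ji nj]|allj] := pselect (exists2 j, (j < i)%N & ~ good j).
  by apply: negligibleS (ih j ji nj); apply: Eset_le; exact: ltnW.
have pos j : (j < i)%N -> (0 < fs_meas (Om j) (Ei j))%E.
  move=> ji; have gj : good j by apply: contrapT => nj; apply: allj; exists j.
  exact: gj.
have [[D [Z [c sh]]] st] := shifted_iter pos.
have mE := shifted_fin_measurable sF sh st.
exists (Ei i); split => //.
have : ~ (0 < fs_meas (Om i) (Ei i))%E.
  move=> Ei0; apply: ngood => j; rewrite leq_eqVlt => /predU1P[->//|].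
  exact: pos.
move/negP; rewrite -leNgt (shifted_meas sh).
have ED : Ei i `<=` D by rewrite -(shifted_set sh) => x [].
rewrite setIidl// => h; apply/eqP; rewrite eq_le measure_ge0 andbT.
by move: h; rewrite pmule_rle0// lte_fin (shifted_gt0 sh).
Qed.

Lemma Eset_measurable i : measurable (Ei i).
Proof.
have [gi|/Eset_negligible/cP//] := pselect (good i).
have [[D [Z [c sh]]] st] := shifted_iter (fun j ji => gi j (ltnW ji)).
exact: (shifted_fin_measurable sF sh st).
Qed.

Lemma Sset_measurable i : measurable (Sset P F tau i).
Proof. by apply: measurableD; exact: Eset_measurable. Qed.

(* [L i k] is the part of [E_i] on which the absolute time of [tau i], counted in
   the original filtration, equals [k]; it is empty when [E_i] is a null set. *)
Record levels (L : nat -> nat -> set T) : Prop := Levels {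
  levels_filt : forall i k, F k (L i k);
  levels_sub : forall i k, L i k `<=` Ei i;
  levels_inj : forall i k l x, L i k x -> L i l x -> k = l;
  levels_cond_exp : forall f f_, measurable_fun [set: T] f ->
    (forall k, cexp P (F k) f (f_ k)) -> (forall k x, 0 <= f_ k x) ->
    forall i, measurable_fun (Ei i) (cond_exp_at P F tau i f) /\
      {ae P, forall x, Ei i x ->
        exists2 k, L i k x & 0 <= cond_exp_at P F tau i f x <= f_ k x} }.

Lemma levels_exist : exists L, levels L.
Proof.
suff /choice[L LP] : forall i, exists Li : nat -> set T,
  [/\ forall k, F k (Li k), forall k, Li k `<=` Ei i,
      forall k l x, Li k x -> Li l x -> k = l
    & forall f f_, measurable_fun [set: T] f ->
      (forall k, cexp P (F k) f (f_ k)) -> (forall k x, 0 <= f_ k x) ->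
      measurable_fun (Ei i) (cond_exp_at P F tau i f) /\
        {ae P, forall x, Ei i x ->
          exists2 k, Li k x & 0 <= cond_exp_at P F tau i f x <= f_ k x}].
  exists L; split.
  - by move=> i; case: (LP i).
  - by move=> i; case: (LP i).
  - by move=> i; case: (LP i).
  - by move=> f f_ mf cf f0 i; case: (LP i) => _ _ _; apply.
(* A null [E_i] gets empty levels: the covering is required almost everywhere only, and completeness
   gives measurability on [E_i]. *)
move=> i; have [gi|/Eset_negligible nE] := pselect (good i); last first.
  exists (fun=> set0); split => //; first by move=> k; exact: sub_sigma0.
  move=> f f_ mf cf f0; split.
    move=> _ B mB; apply: cP; apply: negligibleS nE; exact: subIsetl.
  by apply: negligibleS nE => x /=; apply: contra_notP => nEx Ex.
have [[D [Z [c sh]]] st] := shifted_iter (fun j ji => gi j (ltnW ji)).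
pose Z' x := (Z x + odflt 0 (tau i x))%N.
exists (fun k => Ei i `&` [set x | Z' x = k]); split.
- by move=> k; exact: (shifted_fin_time sF sh st k).
- by move=> k x [].
- by move=> k l x [_ <-] [_ <-].
- move=> f f_ mf cf f0.
  have [mc hc] := cond_exp_stopped_le sF ndF sh st mf cf f0.
  split; first exact: mc.
  have : {ae P, forall x, forall k, (Ei i `&` [set x | Z' x = k]) x ->
      0 <= cond_exp_at P F tau i f x <= f_ k x}.
    exact/ae_foralln.
  by apply: filterS => x hx Ex; exists (Z' x) => //; exact: hx.
Qed.

(** With [f] the indicator of [S_i], sparsity and the upper bound on the conditional expectation
    give [1 <= K f_ k] almost everywhere on [L i k]; this is integrated over [B]. *)
Lemma levels_sparse L i k B : levels L -> F k B -> B `<=` L i k ->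
  (P B <= K%:E * P (B `&` Sset P F tau i))%E.
Proof.
move=> hL FB BL; have mB := (sF k).2 _ FB.
have mS := Sset_measurable i.
pose f : T -> R := \1_(Sset P F tau i).
have mf : measurable_fun [set: T] f by exact: measurable_indic.
have fi : P.-integrable [set: T] (EFin \o f) by exact: integrable_indic.
have f0 x : 0 <= f x by [].
have [f_ [cf f_0]] := nonneg_versions sF fi f0.
have [_ hae] := levels_cond_exp hL mf cf f_0 i.
have [_ _ /(_ i) sae] := sp.
have [mfk fki fkE] := cf k.
have mfkT := meas_wrt_measurable (sF k) mfk.
have K0 : 0 <= K by exact: le_trans K1.
rewrite -[leLHS]mul1e -integral_cst//.
apply: (@le_trans _ _ (\int[P]_(x in B) (K * f_ k x)%:E)%E).
  apply: ae_ge0_le_integral => //.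
  - by move=> x _; rewrite lee_fin mulr_ge0.
  - by apply/measurable_EFinP; apply: measurable_funTS; exact: measurable_funM.
  apply: filterS2 hae sae => x hx sx Bx.
  have Lx := BL _ Bx; have Ex := levels_sub hL Lx.
  have [l Ll /andP[c0 cl]] := hx Ex.
  rewrite (levels_inj hL Lx Ll).
  move: sx; rewrite indicE mem_set//= mulr1 => sx.
  by rewrite lee_fin (le_trans sx)// ler_wpM2l.
under eq_integral do rewrite EFinM.
rewrite ge0_integralZl//; last 2 first.
- by apply/measurable_EFinP; exact: measurable_funTS.
- by move=> x _; rewrite lee_fin.
by rewrite fkE// integral_indic// setIC.
Qed.

End SparseLevels.

(** * The sparse operator *)

(** Here [a], [b], [e] stand for [w_k], [s_k], [t_k]. The two outer exponents add up to [1 / nu], so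
    [a] ends with exponent [1]. *)
Lemma char_exponents {R : realType} (nu p r a b e : R) :
  1 <= nu -> nu + 1 <= p -> 0 < a -> 0 < b -> 0 < e ->
  ((a * b `^ (p - 1)) `^ (p - 1)^-1 *
   (a * e `^ (r - 1)) `^ (nu^-1 - (p - 1)^-1)) `^ nu =
  a * b `^ nu * e `^ ((r - 1) * (1 - nu / (p - 1))).
Proof.
move=> nu1 pnu a0 b0 e0; have [nu_gt0 p1 _] := exponents_pos nu1 pnu.
have nu0 : nu != 0 by rewrite gt_eqF.
have p10 : p - 1 != 0 by rewrite gt_eqF// subr_gt0.
set s1 := (p - 1)^-1; set s2 := nu^-1 - s1.
have ab0 : 0 <= (a * b `^ (p - 1)) `^ s1 := powR_ge0 _ _.
have ae0 : 0 <= (a * e `^ (r - 1)) `^ s2 := powR_ge0 _ _.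
rewrite [LHS](powRM nu ab0 ae0) -(powRrM (a * b `^ (p - 1)) s1 nu).
rewrite -(powRrM (a * e `^ (r - 1)) s2 nu).
rewrite (powRM _ (ltW a0) (powR_ge0 b _)) (powRM _ (ltW a0) (powR_ge0 e _)).
rewrite -(powRrM b _ (s1 * nu)) -(powRrM e _ (s2 * nu)) /s2 /s1.
rewrite (_ : (p - 1) * ((p - 1)^-1 * nu) = nu); last by field.
rewrite (_ : (r - 1) * ((nu^-1 - (p - 1)^-1) * nu) =
  (r - 1) * (1 - nu / (p - 1))); last by field; apply/andP.
rewrite mulrACA -powRD; last by rewrite (gt_eqF a0) implybT.
rewrite (_ : (p - 1)^-1 * nu + (nu^-1 - (p - 1)^-1) * nu = 1); last first.
  by field; apply/andP.
by rewrite powRr1 ?(ltW a0)// mulrA.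
Qed.

Lemma ge0_lee_poweR {R : realType} (r : R) (x y : \bar R) : (0 <= r)%R ->
  (0 <= x -> x <= y -> x `^ r <= y `^ r)%E.
Proof.
move=> r0 x0 xy; apply: gt0_ler_poweR => //; rewrite in_itv/= leey andbT//.
exact: le_trans xy.
Qed.

(** * Almost everywhere bound from the characteristic *)

Section Characteristic.
Context {R : realType} {d : measure_display} {T : measurableType d}.
Variables (P : probability T R) (F : nat -> set_system T).
Local Open Scope ereal_scope.

Lemma ae_le_Lnormy (h : T -> \bar R) :
  {ae P, forall x, `|h x| <= Lnorm P +oo h}.
Proof.
have -> : Lnorm P +oo h = ess_sup P (abse \o h).
  by rewrite unlock/= probability_setT lte01.
exact: ess_sup_ge.
Qed.

Lemma Achar_ge0 p a r b (w : T -> R) : 0 <= Achar P F p a r b w.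
Proof.
apply: le_trans (_ : Aconst P F 0 p w `^ a * Aconst P F 0 r w `^ b <= _).
  by rewrite mule_ge0 ?poweR_ge0.
by apply: ereal_sup_ubound; exists 0%N.
Qed.

(** Each of the two products is almost everywhere at most its essential supremum, their powers
    multiply to at most [W], and [char_exponents] rewrites the power [nu] of the result. *)
Lemma Achar_ae_bound (nu p r : R) (w : T -> R) (w_ sg_ rh_ : T -> R) n :
  (1 <= nu)%R -> (nu + 1 <= p)%R -> (p <= r)%R ->
  let W := Achar P F p (p - 1)^-1 r (nu^-1 - (p - 1)^-1) w in
  W < +oo ->
  (forall x, 0 < w_ x)%R -> (forall x, 0 < sg_ x)%R -> (forall x, 0 < rh_ x)%R ->
  {ae P, forall x, cond_exp (base_space P F) (F n) w x = w_ x} ->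
  {ae P, forall x, cond_exp (base_space P F) (F n) (dual_weight p w) x = sg_ x} ->
  {ae P, forall x, cond_exp (base_space P F) (F n) (dual_weight r w) x = rh_ x} ->
  {ae P, forall x, (w_ x * sg_ x `^ nu * rh_ x `^ ((r - 1) * (1 - nu / (p - 1)))
     <= fine W `^ nu)%R}.
Proof.
move=> nu1 pnu pr W Wy w0 sg0 rh0 aew aesg aerh.
have [nu0 p1 _] := exponents_pos nu1 pnu.
have b0 : (0 <= nu^-1 - (p - 1)^-1)%R.
  by rewrite subr_ge0 lef_pV2 ?posrE ?subr_gt0// lerBrDr.
have W0 : 0 <= W by exact: Achar_ge0.
have W_ub : Aconst P F n p w `^ (p - 1)^-1 *
    Aconst P F n r w `^ (nu^-1 - (p - 1)^-1) <= W.
  by apply: ereal_sup_ubound; exists n.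
clearbody W.
have Wfin : W \is a fin_num by rewrite ge0_fin_numE.
have Ap := @ae_le_Lnormy (fun x => (cond_exp (base_space P F) (F n) w x *
  cond_exp (base_space P F) (F n) (dual_weight p w) x `^ (p - 1))%:E).
have Ar := @ae_le_Lnormy (fun x => (cond_exp (base_space P F) (F n) w x *
  cond_exp (base_space P F) (F n) (dual_weight r w) x `^ (r - 1))%:E).
apply: filterS2 (filterI (filterI aew aesg) aerh) (filterI Ap Ar).
move=> x [[/= ew es] er] [/= hp hr]; move: hp hr; rewrite ew es er.
have a1 : (0 <= w_ x * sg_ x `^ (p - 1))%R by rewrite mulr_ge0 ?powR_ge0// ltW.
have a2 : (0 <= w_ x * rh_ x `^ (r - 1))%R by rewrite mulr_ge0 ?powR_ge0// ltW.
rewrite !ger0_norm// => hp hr.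
rewrite -char_exponents//; apply: ge0_ler_powR; rewrite ?nnegrE.
- exact: ltW.
- by rewrite mulr_ge0 ?powR_ge0.
- exact: fine_ge0.
have p10 : (0 <= (p - 1)^-1)%R by rewrite invr_ge0 subr_ge0 ltW.
have e1 := ge0_lee_poweR p10 (a1 : 0 <= _%:E) hp.
have e2 := ge0_lee_poweR b0 (a2 : 0 <= _%:E) hr.
have := lee_pmul (poweR_ge0 _ _) (poweR_ge0 _ _) e1 e2.
rewrite 2!poweR_EFin -EFinM => h; rewrite -lee_fin (fineK Wfin).
exact: le_trans h W_ub.
Qed.

End Characteristic.

(** * Passage to the limit in the sparse operator *)

Section SparseOperator.
Context {R : realType} {d : measure_display} {T : measurableType d}.
Variables (P : probability T R) (F : nat -> set_system T).
Variables (tau : nat -> T -> option nat) (nu p r K W : R).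
Hypotheses (cP : measure_is_complete P) (sF : forall n, sub_sigma (F n))
  (ndF : forall m n, (m <= n)%N -> F m `<=` F n).
Hypotheses (nu1 : 1 <= nu) (pnu : nu + 1 <= p) (rp : p <= r) (K1 : 1 <= K)
  (sp : conditionally_sparse P F tau K).
Variables (w f : T -> R) (w_ sg_ rh_ f_ : nat -> T -> R).
Hypotheses (w0 : forall x, 0 < w x) (f0 : forall x, 0 <= f x)
  (wi : P.-integrable [set: T] (EFin \o w)) (mf : measurable_fun [set: T] f)
  (sgi : P.-integrable [set: T] (EFin \o dual_weight p w)).
Hypotheses (cw : forall n, cexp P (F n) w (w_ n))
  (csg : forall n, cexp P (F n) (dual_weight p w) (sg_ n))
  (crh : forall n, cexp P (F n) (dual_weight r w) (rh_ n))
  (cf : forall n, cexp P (F n) f (f_ n)).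
Hypotheses (w_0 : forall n x, 0 < w_ n x) (sg_0 : forall n x, 0 < sg_ n x)
  (rh_0 : forall n x, 0 < rh_ n x) (f_0 : forall n x, 0 <= f_ n x).
Hypothesis hW : forall n, {ae P, forall x,
  w_ n x * sg_ n x `^ nu * rh_ n x `^ ((r - 1) * (1 - nu / (p - 1))) <= W `^ nu}.

Variable L : nat -> nat -> set T.
Hypothesis hL : levels P F tau L.

Let term i x := cond_exp_at P F tau i f x `^ nu * \1_(Eset P F tau i) x.
Let q := p / nu.
(** A finite truncation of the operator: steps and absolute times below [N], with [E(f | F k)] on
    each level. The pairs form the finite family of [core_bound]. *)
Let U N x := \sum_(ik : 'I_N * 'I_N) f_ ik.2 x `^ nu * \1_(L ik.1 ik.2) x.

Let mL i k : measurable (L i k).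
Proof. exact: (sF k).2 (levels_filt hL i k). Qed.

Let mf_ n : measurable_fun [set: T] (f_ n).
Proof. by apply: (meas_wrt_measurable (sF n)); case: (cf n). Qed.

Let mw : measurable_fun [set: T] w.
Proof. by apply/measurable_EFinP; exact: measurable_int wi. Qed.

(** The [E_i] decrease, so the [S_i] are disjoint, and the levels of one step are disjoint by
    [levels_inj]. *)
Lemma indic_level_Sset_le1 N x :
  \sum_(ik : 'I_N * 'I_N) \1_(Sset P F tau ik.1 `&` L ik.1 ik.2) x <= 1 :> R.
Proof.
have [[jl jlx]|none] :=
    pselect (exists ik : 'I_N * 'I_N, (Sset P F tau ik.1 `&` L ik.1 ik.2) x).
  rewrite (bigD1 jl)//= big1 ?addr0; last first.
    move=> ik neq; rewrite indicE memNset//= => ikx.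
    case: jlx ikx => -[Ej nEj] Ljl [[Ei nEi] Lik].
    have ij : val ik.1 = val jl.1.
      have [lt|lt|//] := ltngtP (val ik.1) (val jl.1).
        by case: nEi; exact: (Eset_le sp lt).
      by case: nEj; exact: (Eset_le sp lt).
    have kl : val ik.2 = val jl.2.
      by rewrite ij in Lik; exact: (levels_inj hL Lik Ljl).
    move/negP: neq; apply; apply/eqP.
    by case: ik jl ij kl {Ej nEj Ljl Ei nEi Lik} => [i k] [j l] /= /val_inj -> /val_inj ->.
  by rewrite indicE lern1 leq_b1.
rewrite big1// => ik _; rewrite indicE memNset// => ikx.
by apply: none; exists ik.
Qed.

Lemma truncated_bound (N : nat) :
  (\int[P]_x (Num.min N%:R (U N x) `^ q * w x)%:E <=
    (core_const nu p r K * W `^ p)%:E * \int[P]_x (f x `^ p * w x)%:E)%E.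
Proof.
apply: (core_bound sF ndF nu1 pnu rp K1 w0 f0 wi mf sgi cw csg crh cf w_0 sg_0
  rh_0 f_0 hW (lev := fun ik : 'I_N * 'I_N => ik.2 : nat) (N := N)
  (E := fun ik => L ik.1 ik.2) (S := fun ik => Sset P F tau ik.1 `&` L ik.1 ik.2)).
- by move=> ik; exact: ltn_ord.
- by move=> ik; exact: (levels_filt hL).
- by move=> ik; apply: measurableI => //; exact: (Sset_measurable cP sF ndF sp).
- exact: indic_level_Sset_le1.
- move=> ik B FB BL.
  rewrite (_ : B `&` _ = B `&` Sset P F tau ik.1); last first.
    by apply/seteqP; split => x [Bx]; [case|split => //; split => //; exact: BL].
  exact: (levels_sparse cP sF ndF K1 sp hL FB BL).
- exact: ler0n.
Qed.

Let term0 i x : 0 <= term i x.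
Proof. by rewrite mulr_ge0 ?powR_ge0. Qed.

Let U0 N x : 0 <= U N x.
Proof. by apply: sumr_ge0 => ik _; rewrite mulr_ge0 ?powR_ge0. Qed.

Let UE N x : U N x = \sum_(i < N) \sum_(k < N) f_ k x `^ nu * \1_(L i k) x.
Proof. by rewrite /U pair_bigA. Qed.

Let U_nd x m n : (m <= n)%N -> U m x <= U n x.
Proof.
move=> /subnKC <-; rewrite !UE [leRHS]big_split_ord/=.
apply: ler_wpDr.
  by apply: sumr_ge0 => i _; apply: sumr_ge0 => k _; rewrite mulr_ge0 ?powR_ge0.
apply: ler_sum => i _; rewrite [leRHS]big_split_ord/= lerDl.
by apply: sumr_ge0 => k _; rewrite mulr_ge0 ?powR_ge0.
Qed.

Let measurable_term i : measurable_fun [set: T] (term i).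
Proof.
have mE := Eset_measurable cP sF ndF sp i.
have [mc _] := levels_cond_exp hL mf cf f_0 i.
have [nu0 _ _] := exponents_pos nu1 pnu.
(* Measurability is known on [E_i] only; restricting before taking the power gives the same function
   because [0^nu = 0]. *)
rewrite (_ : term i =
  (fun x => ((cond_exp_at P F tau i f) \_ (Eset P F tau i)) x `^ nu)).
  by apply: measurable_fun_powR; apply/(measurable_restrictT _ mE).
apply/funext => x; rewrite /term patchE indicE; case: ifPn => _.
  by rewrite mulr1.
by rewrite mulr0 powR0// gt_eqF.
Qed.

Lemma measurable_sparse_sum :
  measurable_fun [set: T] (fun x => \sum_(0 <= i <oo) (term i x)%:E)%E.
Proof.
apply: ge0_emeasurable_sum => [i x _ _|i _]; first by rewrite lee_fin.
exact/measurable_EFinP/measurable_term.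
Qed.

Lemma terms_le_levels : {ae P, forall x, forall n,
  exists N, forall M, (N <= M)%N -> \sum_(i < n) term i x <= U M x}.
Proof.
have /ae_foralln : forall i, {ae P, forall x, Eset P F tau i x ->
    exists2 k, L i k x & 0 <= cond_exp_at P F tau i f x <= f_ k x}.
  by move=> i; have [] := levels_cond_exp hL mf cf f_0 i.
apply: filterS => x hx n.
have [nu0 _ _] := exponents_pos nu1 pnu.
have /choice[k_ k_P] : forall i, exists k,
    term i x <= f_ k x `^ nu * \1_(L i k) x.
  move=> i; rewrite /term; have [Ex|nEx] := pselect (Eset P F tau i x).
    have [k Lk /andP[c0 ck]] := hx i Ex; exists k.
    rewrite !indicE !mem_set//= !mulr1.
    by apply: ge0_ler_powR; rewrite ?nnegrE// ltW.
  by exists 0%N; rewrite indicE memNset// mulr0 mulr_ge0 ?powR_ge0.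
(* The sum of the [(k_ i).+1] exceeds every [k_ i], so all pairs of [i] and [k_ i] are below [M]. *)
exists (n + \sum_(i < n) (k_ i).+1)%N => M NM; rewrite UE.
have nM : (n <= M)%N by apply: leq_trans NM; exact: leq_addr.
rewrite -(subnKC nM) in NM *.
rewrite [leRHS]big_split_ord/=; apply: ler_wpDr.
  by apply: sumr_ge0 => i _; apply: sumr_ge0 => k _; rewrite mulr_ge0 ?powR_ge0.
apply: ler_sum => i _; apply: (le_trans (k_P i)).
have kM : (k_ i < n + (M - n))%N.
  apply: leq_trans NM; apply: leq_trans (leq_addl _ _).
  by rewrite (bigD1 i)//= leq_addr.
rewrite (bigD1 (Ordinal kM))//= lerDl sumr_ge0// => k _.
by rewrite mulr_ge0 ?powR_ge0.
Qed.

Lemma sparse_sum_bound :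
  (\int[P]_x ((\sum_(0 <= i <oo) (term i x)%:E) `^ q * (w x)%:E) <=
    (core_const nu p r K * W `^ p)%:E * \int[P]_x (f x `^ p * w x)%:E)%E.
Proof.
have [nu0 p1 _] := exponents_pos nu1 pnu.
have q0 : 0 < q by rewrite divr_gt0// (lt_trans ltr01).
(* [N] is both the truncation level and the size of the family, so one monotone limit removes
   both. *)
pose V N x := Num.min N%:R (U N x) `^ q.
have min0 N x : 0 <= Num.min N%:R (U N x) by rewrite le_min ler0n/=.
have V0 N x : 0 <= V N x by exact: powR_ge0.
have V_nd x m n : (m <= n)%N -> V m x <= V n x.
  move=> mn; apply: ge0_ler_powR; rewrite ?nnegrE//; first exact: ltW.
  by rewrite le_min !ge_min ler_nat mn/= U_nd ?orbT.
have mV N : measurable_fun [set: T] (V N).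
  apply: measurable_fun_powR; apply: measurable_minr => //.
  apply: measurable_sum => ik; apply: measurable_funM; last exact: measurable_indic.
  exact: measurable_fun_powR.
have cvgV x : (V n x)%:E @[n --> \oo] --> limn (fun n => (V n x)%:E).
  by apply: ereal_nondecreasing_is_cvgn => m n mn; rewrite lee_fin V_nd.
pose Vb x := limn (fun n => (V n x)%:E).
have V_le n x : ((V n x)%:E <= Vb x)%E.
  apply: lime_ge; first exact: cvgV.
  by exists n => // m /= nm; rewrite lee_fin V_nd.
have Vb0 x : (0 <= Vb x)%E by apply: le_trans (V_le 0%N x); rewrite lee_fin.
have cvgVw x : (V n x * w x)%:E @[n --> \oo] --> (Vb x * (w x)%:E)%E.
  under eq_fun do rewrite EFinM.
  by apply: cvgeZr => //; exact: cvgV.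
have mVw n : measurable_fun [set: T] (fun x => (V n x * w x)%:E).
  by apply/measurable_EFinP; exact: measurable_funM.
have bnd : (\int[P]_x (Vb x * (w x)%:E) <=
    (core_const nu p r K * W `^ p)%:E * \int[P]_x (f x `^ p * w x)%:E)%E.
  apply: (@cvg_integral_le _ _ _ P (fun n x => (V n x * w x)%:E)) => //.
  - by move=> n x; rewrite lee_fin mulr_ge0// ltW.
  - by move=> x m n mn; rewrite lee_fin ler_wpM2r ?V_nd// ltW.
  - exact: truncated_bound.
apply: le_trans bnd; apply: ae_ge0_le_integral => //.
- by move=> x _; rewrite mule_ge0 ?poweR_ge0// lee_fin ltW.
- apply: emeasurable_funM; last exact/measurable_EFinP.
  exact: (measurableT_comp (measurable_poweR q) measurable_sparse_sum).
- by move=> x _; rewrite mule_ge0// lee_fin ltW.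
- apply: (@emeasurable_fun_cvg _ _ _ _ (fun n x => (V n x * w x)%:E)) => //.
apply: filterS terms_le_levels => x hx _.
apply: lee_wpmul2r; first by rewrite lee_fin ltW.
(* Comparing [q]-th roots reduces the claim to a bound for each partial sum. *)
have -> : Vb x = ((Vb x `^ q^-1) `^ q)%E.
  by rewrite -poweRrM mulVf ?gt_eqF// poweRe1.
apply: gt0_ler_poweR; rewrite ?in_itv/= ?leey ?andbT ?poweR_ge0 ?(ltW q0)//.
  by apply: nneseries_ge0 => i _ _; rewrite lee_fin.
apply: lime_le.
  by apply: is_cvg_nneseries => i _ _; rewrite lee_fin.
apply: nearW => n; rewrite sumEFin big_mkord.
have [N NP] := hx n.
pose y := \sum_(i < n) term i x.
have y0 : 0 <= y by rewrite sumr_ge0.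
(* Large enough for [U M] to dominate the partial sum [y] and for the truncation level to exceed
   it. *)
pose M := (N + (Num.trunc y).+1)%N.
have yM : y <= Num.min M%:R (U M x).
  rewrite le_min NP ?leq_addr// andbT.
  apply: ltW; apply: lt_le_trans (truncnS_gt y) _.
  by rewrite ler_nat leq_addl.
rewrite -/y (_ : y%:E = (((y `^ q)%:E) `^ q^-1)%E); last first.
  by rewrite -poweR_EFin -poweRrM mulfV ?gt_eqF// poweRe1.
apply: gt0_ler_poweR; rewrite ?in_itv/= ?leey ?andbT ?lee_fin ?powR_ge0//.
  by rewrite invr_ge0 ltW.
apply: le_trans (V_le M x); rewrite lee_fin.
by apply: ge0_ler_powR; rewrite ?nnegrE// ltW.
Qed.

End SparseOperator.

(** * Integrability, choice of versions and conclusion *)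

Lemma le_young_dual {R : realType} (p a v : R) : 1 < p -> 0 <= a -> 0 < v ->
  a <= a `^ p * v + v `^ (- (p - 1)^-1).
Proof.
move=> p1 a0 v0; have p0 : 0 < p := lt_trans ltr01 p1.
have p10 : 0 < p - 1 by rewrite subr_gt0.
have := young_weighted p1 a0 ler01 (ltW v0) (powR_ge0 v (- (p - 1)^-1)).
rewrite powR1 !mul1r -(powRrM v (- (p - 1)^-1)) -mulrA -powRD; last first.
  by rewrite (gt_eqF v0) implybT.
rewrite (_ : p^-1 + - (p - 1)^-1 * (p / (p - 1))^-1 = 0) ?powRr0 ?mulr1//.
by field; rewrite !gt_eqF.
Qed.

(** Since [1/(r-1) <= 1/(p-1)], the first term suffices for [v >= 1] and the second for [v < 1].
    This makes [w^(-1/(r-1))] integrable. *)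
Lemma dual_weight_le_add1 {R : realType} (p r v : R) : 1 < p -> p <= r -> 0 < v ->
  v `^ (- (r - 1)^-1) <= 1 + v `^ (- (p - 1)^-1).
Proof.
move=> p1 pr v0; have p10 : 0 < p - 1 by rewrite subr_gt0.
have r10 : 0 < r - 1 by rewrite subr_gt0 (lt_le_trans p1).
have [v1|v1] := leP 1 v.
  apply: (@le_trans _ _ 1); last by rewrite lerDl powR_ge0.
  by rewrite -[leRHS](powRr0 v); apply: ler_powR => //; rewrite oppr_le0 invr_ge0 ltW.
apply: (@le_trans _ _ (v `^ (- (p - 1)^-1))); last by rewrite lerDr ler01.
apply: ger_powR; first by rewrite v0 ltW.
by rewrite lerN2 lef_pV2 ?posrE// lerB.
Qed.

Lemma core_const_ge0 {R : realType} (nu p r K : R) : 0 <= core_const nu p r K.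
Proof.
apply: mulr_ge0; first exact: ler0n.
by apply: mulr_ge0; [exact: powR_ge0|exact: doob_const_ge0].
Qed.

Lemma cexp_cond_exp {R : realType} {d : measure_display} {T : measurableType d}
    (P : probability T R) (F : nat -> set_system T) n (f : T -> R) :
  sub_sigma (F n) -> P.-integrable [set: T] (EFin \o f) ->
  cexp P (F n) f (cond_exp (base_space P F) (F n) f).
Proof.
move=> sFn fi; apply/(is_cond_exp_base P F) => //.
suff : exists g, [set g | is_cond_exp (base_space P F) (F n) f g] g.
  exact: (@xgetPex _ (cst 0)).
have [g cg] := cexp_exists sFn fi.
by exists g; apply/is_cond_exp_base.
Qed.

(** A weight is positive only almost everywhere, so it is replaced by [f']; the last clause keeps
    the link with the [cond_exp] of the original function that defines the characteristic. *)
Lemma positive_versions {R : realType} {d : measure_display} {T : measurableType d}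
    (P : probability T R) (F : nat -> set_system T) (f f' : T -> R) :
  (forall n, sub_sigma (F n)) -> P.-integrable [set: T] (EFin \o f) ->
  measurable_fun [set: T] f' -> (forall x, 0 < f' x) ->
  {ae P, forall x, f x = f' x} ->
  exists f_ : nat -> T -> R, [/\ forall n, cexp P (F n) f' (f_ n),
    forall n x, 0 < f_ n x
    & forall n, {ae P, forall x, cond_exp (base_space P F) (F n) f x = f_ n x}].
Proof.
move=> sF fi mf' f'0 ff'.
have mf : measurable_fun [set: T] f by apply/measurable_EFinP; exact: measurable_int fi.
have f'i := integrable_ae_eq fi mf' ff'.
have /choice[f_ f_P] : forall n, exists g, cexp P (F n) f' g /\
    ((forall x, 0 < g x) /\
     {ae P, forall x, cond_exp (base_space P F) (F n) f x = g x}).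
  move=> n; have cE := cexp_congr (sF n) mf mf' ff' (cexp_cond_exp (sF n) fi).
  by have [g cg [g0 ge]] := cexp_gt0_version (sF n) f'i f'0 cE; exists g.
by exists f_; split => n; have [? []] := f_P n.
Qed.

Theorem theorem1p5 (R : realType) (nu p r K : R)
    (hnu : 1 <= nu) (hp : nu + 1 <= p) (hr : p <= r) (hK : 1 <= K) :
  exists C : R,
  forall (d : measure_display) (T : measurableType d) (P : probability T R)
    (F : nat -> set_system T) (w : T -> R) (tau : nat -> T -> option nat),
  let wconst := Achar P F p (p - 1)^-1 r (nu^-1 - (p - 1)^-1) w in
  filtered_probability_space P F ->
  weight P w ->
  P.-integrable [set: T] (EFin \o dual_weight p w) ->
  (wconst < +oo)%E ->
  conditionally_sparse P F tau K ->
  forall f : T -> R, in_wLp P p w f ->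
  (wLnorm P p w (sparse_op P F tau nu (fun x => `|f x|%R))
    <= C%:E * wconst * wLnorm P p w (EFin \o f))%E.
Proof.
exists (core_const nu p r K `^ p^-1).
move=> d T P F w tau wconst [cP sF ndF _ _] [wi w_pos] sgi Wy sp f [mf flt].
have [nu0 p1 _] := exponents_pos hnu hp.
have p0 : 0 < p := lt_trans ltr01 p1.
have mw : measurable_fun [set: T] w by apply/measurable_EFinP; exact: measurable_int wi.
pose v x := if 0 < w x then w x else 1.
have v0 x : 0 < v x by rewrite /v; case: ifPn.
have mv : measurable_fun [set: T] v.
  by apply: measurable_fun_ifT => //; exact: measurable_fun_ltr.
have wv : {ae P, forall x, w x = v x}.
  by apply: filterS w_pos => x wx; rewrite /v wx.
have vi := integrable_ae_eq wi mv wv.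
have mdual q (u : T -> R) : measurable_fun [set: T] u ->
    measurable_fun [set: T] (dual_weight q u) by exact: measurable_fun_powR.
have dual0 q x : 0 < dual_weight q v x by exact: powR_gt0.
have dual_ae q : {ae P, forall x, dual_weight q w x = dual_weight q v x}.
  by apply: filterS wv => x e; rewrite /dual_weight e.
have sgvi := integrable_ae_eq sgi (mdual p v mv) (dual_ae p).
have rhvi : P.-integrable [set: T] (EFin \o dual_weight r v).
  apply: (@le_integrable _ _ _ P _ measurableT _
    (EFin \o (fun x => 1 + dual_weight p v x))).
  - exact/measurable_EFinP/mdual.
  - move=> x _ /=; rewrite lee_fin ger0_norm ?(ltW (dual0 r x))// ger0_norm.
      exact: dual_weight_le_add1.
    by rewrite addr_ge0// ltW.
  - apply: (@integrableD _ _ _ P _ measurableT (EFin \o cst 1) _ _ sgvi).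
    exact: finite_measure_integrable_cst.
have rhi : P.-integrable [set: T] (EFin \o dual_weight r w).
  apply: (integrable_ae_eq rhvi (mdual r w mw)).
  by apply: filterS (dual_ae r) => x ->.
have [w_ [cw w_0 aew]] := positive_versions sF wi mv v0 wv.
have [sg_ [csg sg_0 aesg]] :=
  positive_versions sF sgi (mdual p v mv) (dual0 p) (dual_ae p).
have [rh_ [crh rh_0 aerh]] :=
  positive_versions sF rhi (mdual r v mv) (dual0 r) (dual_ae r).
have hW n := Achar_ae_bound hnu hp hr Wy (w_0 n) (sg_0 n) (rh_0 n)
  (aew n) (aesg n) (aerh n).
pose g x := `|f x|.
have mg : measurable_fun [set: T] g by exact: measurableT_comp.
have g0 x : 0 <= g x by exact: normr_ge0.
pose J := (\int[P]_x (g x `^ p * v x)%:E)%E.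
have mgv : measurable_fun [set: T] (fun x => g x `^ p * v x).
  by apply: measurable_funM => //; exact: measurable_fun_powR.
have gv0 x : 0 <= g x `^ p * v x by rewrite mulr_ge0 ?powR_ge0// ltW.
have J0 : (0 <= J)%E by apply: integral_ge0 => x _; rewrite lee_fin.
have normf : wLnorm P p w (EFin \o f) = (J `^ p^-1)%E.
  rewrite /wLnorm; congr (_ `^ _)%E.
  transitivity (\int[P]_x (g x `^ p * w x)%:E)%E; first exact: eq_integral.
  apply: ae_eq_integral => //.
  - apply/measurable_EFinP; apply: measurable_funM => //.
    exact: measurable_fun_powR.
  - exact/measurable_EFinP.
  - by apply: filterS wv => x e _ /=; rewrite e.
have Jy : (J < +oo)%E.
  by move: flt; rewrite normf => /lty_poweRy; apply; rewrite invr_eq0 gt_eqF.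
(* Young's inequality bounds [g] by [g^p v] plus the dual weight, so [g] is integrable and has
   conditional expectations. *)
have gi : P.-integrable [set: T] (EFin \o g).
  apply: (@le_integrable _ _ _ P _ measurableT _
    (EFin \o (fun x => g x `^ p * v x + dual_weight p v x))).
  - exact/measurable_EFinP.
  - move=> x _ /=; rewrite lee_fin ger0_norm// ger0_norm; first exact: le_young_dual.
    by rewrite addr_ge0// ltW.
  - apply: (@integrableD _ _ _ P _ measurableT
      (EFin \o (fun x => g x `^ p * v x)) _ _ sgvi).
    apply/integrableP; split; first exact/measurable_EFinP.
    by under eq_integral do rewrite /= ger0_norm//.
have [g_ [cg g_0]] := nonneg_versions sF gi g0.
have [L hL] := levels_exist cP sF ndF sp.
have := sparse_sum_bound cP sF ndF hnu hp hr hK sp v0 g0 vi mg sgvi cw csg crh cg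
  w_0 sg_0 rh_0 g_0 hW hL.
have := measurable_sparse_sum cP sF ndF hnu hp sp mg cg g_0 hL.
pose Y x := (\sum_(0 <= i <oo)
  (cond_exp_at P F tau i g x `^ nu * \1_(Eset P F tau i) x)%:E)%E.
rewrite -/Y => mY; rewrite -/J => bnd.
have mYq : measurable_fun [set: T] (fun x => (Y x `^ (p / nu))%E).
  exact: (measurableT_comp (measurable_poweR _) mY).
have W0 : (0 <= wconst)%E by exact: Achar_ge0.
have Wfin : wconst \is a fin_num by rewrite ge0_fin_numE.
have norm_sparse : wLnorm P p w (sparse_op P F tau nu g) =
    ((\int[P]_x (Y x `^ (p / nu) * (v x)%:E)) `^ p^-1)%E.
  rewrite /wLnorm; congr (_ `^ _)%E.
  transitivity (\int[P]_x (Y x `^ (p / nu) * (w x)%:E))%E.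
    apply: eq_integral => x _; congr (_ * _)%E.
    by rewrite /sparse_op gee0_abs ?poweR_ge0// -poweRrM mulrC.
  apply: ae_eq_integral => //.
  - by apply: emeasurable_funM => //; exact/measurable_EFinP.
  - by apply: emeasurable_funM => //; exact/measurable_EFinP.
  - by apply: filterS wv => x e _ /=; rewrite e.
rewrite norm_sparse normf.
have c0 := core_const_ge0 nu p r K.
have cW0 : 0 <= core_const nu p r K * fine wconst `^ p by rewrite mulr_ge0 ?powR_ge0.
(* Taking [p]-th roots turns [W^p] into the first power of the characteristic. *)
apply: le_trans (ge0_lee_poweR _ _ bnd) _.
- by rewrite invr_ge0 ltW.
- by apply: integral_ge0 => x _; rewrite mule_ge0 ?poweR_ge0// lee_fin ltW.
rewrite poweRM//.
rewrite poweR_EFin powRM ?powR_ge0// -powRrM mulfV ?gt_eqF// powRr1 ?fine_ge0//.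
by rewrite EFinM fineK.
Qed.
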